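(* Let $\Omega\subset\mathbb{C}^n$ be a bounded pseudoconvex domain. Suppose $\phi:\Omega\to\Omega$ is a holomorphic self-map of $\Omega$ such that $\overline{\phi(\Omega)}\subset\Omega$. Then the composition operator $C_\phi$, $C_\phi(f)=f\circ\phi$, is compact on $A^2(\Omega)$.
   Context: $A^2(\Omega)$ is the Bergman space of holomorphic functions $f:\Omega\to\mathbb{C}$ with $\int_\Omega |f|^2\,dV<\infty$, where $V$ is Lebesgue volume measure, with norm $\|f\|_{2,\Omega}=\left(\int_\Omega|f|^2\,dV\right)^{1/2}$. A linear operator between Banach spaces is compact if the image of the open unit ball is relatively compact in norm. *)

(* Defs.v *)
From HB Require Import structures.
From mathcomp Require Import all_boot all_order all_algebra.
From mathcomp Require Import all_classical all_reals all_analysis.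
From mathcomp Require Import measurable_realfun complex.

Set Implicit Arguments.
Unset Strict Implicit.
Unset Printing Implicit Defensive.

Import Order.TTheory GRing.Theory Num.Theory.
Import numFieldNormedType.Exports.

Local Open Scope classical_set_scope.
Local Open Scope complex_scope.
Local Open Scope ring_scope.

Section product_sigma_finite.
Local Open Scope ereal_scope.
Context d1 d2 (T1 : measurableType d1) (T2 : measurableType d2) (R : realType).
Context (m1 : {sigma_finite_measure set T1 -> \bar R}).
Context (m2 : {sigma_finite_measure set T2 -> \bar R}).

(* The library's product is not recognised as a sigma-finite measure; this copy
   is, so that it can be iterated. *)
Definition prodm : set (T1 * T2) -> \bar R := m1 \x m2.

HB.instance Definition _ := Measure.on prodm.

Let prodm_sigma_finite : sigma_finite setT prodm.
Proof.
have /sigma_finiteP[F [TF ndF Foo]] := sigma_finiteT m1.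
have /sigma_finiteP[G [TG ndG Goo]] := sigma_finiteT m2.
exists (fun n => F n `*` G n).
  rewrite -setXTT TF TG predeqE => -[x y]; split.
    move=> [/= [n _ Fnx] [k _ Gky]]; exists (maxn n k) => //; split.
    - by move: x Fnx; exact/subsetPset/ndF/leq_maxl.
    - by move: y Gky; exact/subsetPset/ndG/leq_maxr.
  by move=> [n _ []/= ? ?]; split; exists n.
move=> k; have [mF Fk] := Foo k; have [mG Gk] := Goo k.
split; first exact: measurableX.
rewrite /prodm product_measure1E//.
by rewrite lte_mul_pinfty// ge0_fin_numE.
Qed.

HB.instance Definition _ :=
  Measure_isSigmaFinite.Build _ _ _ prodm prodm_sigma_finite.

End product_sigma_finite.

Definition consT (T : Type) n (p : T * n.-tuple T) : n.+1.-tuple T :=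
  [tuple of p.1 :: p.2].

Section tuple_measure.
Context d (T : measurableType d) (R : realType).

Lemma measurable_consT n : measurable_fun [set: T * n.-tuple T] (@consT T n).
Proof. exact: measurable_cons. Qed.

Section step.
Context (m : {sigma_finite_measure set T -> \bar R}) (n : nat).
Context (m' : {sigma_finite_measure set (n.-tuple T) -> \bar R}).

(* [m \x m'] transported along (x, t) |-> x :: t. *)
Definition cons_measure : set (n.+1.-tuple T) -> \bar R :=
  fun A => prodm m m' (@consT T n @^-1` A).

Let cons0 : cons_measure set0 = 0%E.
Proof. by rewrite /cons_measure preimage_set0 measure0. Qed.

Let cons_ge0 A : (0 <= cons_measure A)%E.
Proof. exact: measure_ge0. Qed.

Let cons_additive : semi_sigma_additive cons_measure.
Proof.
move=> F mF tF mUF; rewrite /cons_measure preimage_bigcup.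
apply: measure_semi_sigma_additive.
- by move=> k; rewrite -[X in measurable X]setTI; exact: measurable_consT.
- by apply/trivIsetP => /= i j _ _ ij; rewrite -preimage_setI;
    move/trivIsetP : tF => /(_ i j Logic.I Logic.I ij) ->; rewrite preimage_set0.
- by rewrite -preimage_bigcup -[X in measurable X]setTI; exact: measurable_consT.
Qed.

HB.instance Definition _ :=
  isMeasure.Build _ _ _ cons_measure cons0 cons_ge0 cons_additive.

Let cons_sigma_finite : sigma_finite setT cons_measure.
Proof.
have [F FT Foo] := sigma_finiteT (prodm m m').
pose g (t : n.+1.-tuple T) := (thead t, [tuple of behead t]).
have gK : cancel (@consT T n) g.
  by move=> [x t]; rewrite /g /consT/=; congr (_, _); exact/val_inj.
have mg : measurable_fun setT g.
  apply: measurable_fun_pair => /=; last exact: measurable_behead.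
  exact: measurable_tnth.
exists (fun k => g @^-1` (F k)).
  by rewrite -preimage_bigcup -FT preimage_setT.
move=> k; have [mF Fk] := Foo k; split.
  by rewrite -[X in measurable X]setTI; exact: mg.
rewrite /cons_measure -comp_preimage.
by rewrite (_ : g \o @consT T n = id) //; apply/funext => x /=; rewrite gK.
Qed.

HB.instance Definition _ :=
  Measure_isSigmaFinite.Build _ _ _ cons_measure cons_sigma_finite.

End step.

(* The n-fold product of m, on the product sigma-algebra of n.-tuple T. *)
Fixpoint tuple_measure (m : {sigma_finite_measure set T -> \bar R}) (n : nat) :
    {sigma_finite_measure set (n.-tuple T) -> \bar R} :=
  match n with
  | 0 => \d_([tuple])
  | k.+1 => cons_measure m (tuple_measure m k)
  end.

End tuple_measure.

Definition lebesgue2 (R : realType) :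
    {sigma_finite_measure set (measurableTypeR R * measurableTypeR R)%type -> \bar R} :=
  prodm lebesgue_measure lebesgue_measure.

(* The library puts a topology on every abstract numClosedFieldType K through
   K^o; the same is done here for the concrete R[i]. *)
#[export, non_forgetful_inheritance]
HB.instance Definition _ (R : realType) := NormedModule.copy R[i] R[i]^o.

(* The identification of R^2n, seen as (R * R)^n, with C^n. *)
Definition cvec (R : realType) n (t : n.-tuple (measurableTypeR R * measurableTypeR R)) :
  'rV[R[i]]_n := \row_i ((tnth t i).1 +i* (tnth t i).2).

(* Lebesgue measure on (R * R)^n; the volume of D in C^n is that of its preimage
   by [cvec]. *)
Definition volume (R : realType) n := tuple_measure (lebesgue2 R) n.

Lemma tuple_measureX d (T : measurableType d) (R : realType)
    (m : {sigma_finite_measure set T -> \bar R}) n (A : 'I_n -> set T) :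
  (forall i, measurable (A i)) ->
  measurable [set t : n.-tuple T | forall i, A i (tnth t i)] /\
  tuple_measure m n [set t : n.-tuple T | forall i, A i (tnth t i)] =
    (\prod_(i < n) m (A i))%E.
Proof.
elim: n A => [|n IH] A mA.
  have -> : [set t : 0.-tuple T | forall i, A i (tnth t i)] = setT.
    by apply/seteqP; split=> // t _ [].
  by split=> //=; rewrite diracE in_setT big_ord0.
have [mB BE] := IH (A \o lift ord0) (fun i => mA (lift ord0 i)).
set S := [set _ | _].
have mS : measurable S.
  have -> : S = \bigcap_(i in [set: 'I_n.+1]) ((@tnth _ T ^~ i) @^-1` A i).
    by apply/seteqP; split=> t /= h i => [_|]; exact: h.
  apply: fin_bigcap_measurable; first exact: finite_finset.
  by move=> i _; rewrite -[X in measurable X]setTI; exact: measurable_tnth.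
split=> //; rewrite /= /cons_measure.
have -> : @consT T n @^-1` S = A ord0 `*`
    [set t : n.-tuple T | forall i, A (lift ord0 i) (tnth t i)].
  apply/seteqP; split=> -[x t] /=.
    move=> h; split; first by have := h ord0; rewrite tnth0.
    by move=> i; have := h (lift ord0 i); rewrite tnthS.
  move=> [h1 h2] i; case: (unliftP ord0 i) => [j|] ->; last by rewrite tnth0.
  by rewrite tnthS; exact: h2.
by rewrite [LHS]product_measure1E// big_ord_recl; congr (_ * _)%E.
Qed.

Section volume_facts.
Context (R : realType) (n : nat).
Local Notation T := (measurableTypeR R * measurableTypeR R)%type.
Implicit Types (U : set 'rV[R[i]]_n) (t : n.-tuple T).

Lemma normc_leD (a b : R) : `|a +i* b| <= (`|a| + `|b|)%:C :> R[i].
Proof.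
rewrite normc_def lecR /=.
rewrite -[leRHS]ger0_norm ?addr_ge0// -sqrtr_sqr.
rewrite ler_wsqrtr// sqrrD !real_normK ?num_real//.
by rewrite -addrA lerD2l lerDr mulrn_wge0// mulr_ge0.
Qed.

Let box (q : n.-tuple (rat * rat)) (k : nat) : set (n.-tuple T) :=
  [set t | forall i, `|(tnth t i).1 - ratr (tnth q i).1| < k.+1%:R^-1 /\
                     `|(tnth t i).2 - ratr (tnth q i).2| < k.+1%:R^-1].

Let measurable_box q k : measurable (box q k).
Proof.
have -> : box q k = \bigcap_(i in [set: 'I_n]) ((@tnth n T ^~ i) @^-1`
    (ball (ratr (tnth q i).1 : R) k.+1%:R^-1 `*` ball (ratr (tnth q i).2 : R) k.+1%:R^-1)).
  apply/seteqP; split=> t /=.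
    by move=> + i _ => /(_ i)[h1 h2]; split; rewrite /ball/= distrC.
  by move=> + i => /(_ i Logic.I)[h1 h2]; split; rewrite distrC.
apply: fin_bigcap_measurable; first exact: finite_finset.
move=> i _; rewrite -[X in measurable X]setTI.
by apply: measurable_tnth => //; apply: measurableX; rewrite ball_itv; exact: measurable_itv.
Qed.

Let nbhs_cvec t U : open U -> U (cvec t) ->
  exists q k, box q k t /\ box q k `<=` @cvec R n @^-1` U.
Proof.
move=> oU Ut.
have /nbhs_ballP[e e0 eU] : nbhs (cvec t) U by exact: open_nbhs_nbhs.
have er : (complex.Re e)%:C = e by rewrite RRe_real// gtr0_real.
have {}e0 : 0 < complex.Re e by rewrite -ltcR er.
have [k ke] : exists k, 4 * k.+1%:R^-1 < complex.Re e.
  have e40 : 0 < complex.Re e / 4 by rewrite divr_gt0.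
  have [k kP] := ltr_add_invr e40.
  by exists k; move: kP; rewrite add0r ltr_pdivlMr// mulrC.
have k0 : 0 < k.+1%:R^-1 :> R by rewrite invr_gt0.
have H (x : R) : {q | `|x - ratr q| < k.+1%:R^-1}.
  apply: cid; have /rat_in_itvoo[q /itvP qx] : x < x + k.+1%:R^-1 by rewrite ltrDl.
  by exists q; rewrite distrC ger0_norm ?subr_ge0 ?qx// ltrBlDl qx.
exists [tuple (sval (H (tnth t i).1), sval (H (tnth t i).2)) | i < n], k.
split=> [i|s bs]; rewrite ?tnth_mktuple/=; first by split; exact: (svalP (H _)).
apply: eU; split; first by rewrite -er ltcR.
move=> i j; rewrite !mxE /ball/=.
have [] := bs j; rewrite tnth_mktuple/= => s1 s2.
case: (H _) s1 => p1 /= t1 s1; case: (H _) s2 => p2 /= t2 s2.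
apply: le_lt_trans (normc_leD _ _) _; rewrite -er ltcR.
apply: le_lt_trans ke.
have -> : 4 * k.+1%:R^-1 = (k.+1%:R^-1 + k.+1%:R^-1) + (k.+1%:R^-1 + k.+1%:R^-1) :> R.
  by rewrite -!mulr2n -mulrnA mulr_natl.
apply: lerD.
  by apply: le_trans (ler_distD (ratr p1) _ _) _; rewrite (distrC (ratr p1)) lerD// ltW.
by apply: le_trans (ler_distD (ratr p2) _ _) _; rewrite (distrC (ratr p2)) lerD// ltW.
Qed.

Lemma open_cvec_measurable U : open U -> measurable (@cvec R n @^-1` U).
Proof.
move=> oU; pose B (p : n.-tuple (rat * rat) * nat) :=
  if `[< box p.1 p.2 `<=` @cvec R n @^-1` U >] then box p.1 p.2 else set0.
have -> : @cvec R n @^-1` U = \bigcup_p B p.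
  apply/seteqP; split=> t.
    move=> /(nbhs_cvec oU)[q [k [tq qU]]]; exists (q, k) => //.
    by rewrite /B/= asboolT.
  by move=> [p _]; rewrite /B; case: asboolP => // h; exact: h.
apply: countable_bigcupT_measurable => // p; rewrite /B; case: ifP => // _.
Qed.

Lemma open_volume_gt0 U : open U -> U !=set0 ->
  (0 < volume R n (@cvec R n @^-1` U))%E.
Proof.
move=> oU [z Uz].
pose t : n.-tuple T := [tuple (complex.Re (z ord0 i), complex.Im (z ord0 i)) | i < n].
have tz : cvec t = z.
  apply/rowP => i; rewrite mxE tnth_mktuple/=.
  by case: (z ord0 i).
have [|q [k [tq qU]]] := @nbhs_cvec t U oU; first by rewrite tz.
apply: (@lt_le_trans _ _ (volume R n (box q k))); last first.
  apply: le_measure => //; rewrite inE; first exact: measurable_box.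
  exact: open_cvec_measurable.
pose A i := ball (ratr (tnth q i).1 : R) k.+1%:R^-1 `*`
            ball (ratr (tnth q i).2 : R) k.+1%:R^-1 : set T.
have -> : box q k = [set t : n.-tuple T | forall i, A i (tnth t i)].
  apply/seteqP; split=> s /= + i => /(_ i)[h1 h2];
    by split; move: h1 h2; rewrite /ball/= distrC// => _; rewrite distrC.
have mb (x : R) : measurable (ball x k.+1%:R^-1 : set (measurableTypeR R)).
  by rewrite ball_itv; exact: measurable_itv.
have [i|_ ->] := @tuple_measureX _ _ _ (lebesgue2 R) n A; first exact: measurableX.
elim/big_ind: _ => //; [by move=> *; exact: mule_gt0|move=> i _].
rewrite [X in (_ < X)%E]product_measure1E//.
by apply: mule_gt0; rewrite [X in (_ < X)%E]lebesgue_measure_ball// lte_fin pmulrn_lgt0.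
Qed.

Lemma measurable_cvec_cont U (g : 'rV[R[i]]_n -> R) : open U ->
  (forall z, U z -> {for z, continuous g}) ->
  measurable_fun (@cvec R n @^-1` U) (g \o @cvec R n).
Proof.
move=> oU gc mD; apply: (measurability _ (RGenOInfty.measurableE R)) => //.
move=> /= _ [_ [x ->] <-].
have -> : @cvec R n @^-1` U `&` (g \o @cvec R n) @^-1` `]x, +oo[%classic =
    @cvec R n @^-1` (U `&` [set z | x < g z]).
  by apply/seteqP; split=> t /=; rewrite in_itv/= andbT.
apply: open_cvec_measurable; rewrite openE => z [Uz xz].
apply: filterI; first exact: open_nbhs_nbhs.
have : nbhs (g z) [set y | x < y].
  by apply: open_nbhs_nbhs; split => //; exact: open_gt.
by move/(gc z Uz).
Qed.

End volume_facts.

(* Complex differentiability when K = R[i]; for D open it only depends on the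
   values of f on D. *)
Definition holomorphic_on (K : numFieldType) (V W : normedModType K)
  (D : set V) (f : V -> W) := forall z, D z -> differentiable f z.

(* The integral of |f|^2 over Omega. *)
Definition sq_int (R : realType) n (Omega : set 'rV[R[i]]_n)
    (f : 'rV[R[i]]_n -> R[i]) : \bar R :=
  (\int[volume R n]_(t in @cvec R n @^-1` Omega)
     ((Normc.normc (f (cvec t))) ^+ 2)%:E)%E.

Definition L2norm (R : realType) n (Omega : set 'rV[R[i]]_n)
    (f : 'rV[R[i]]_n -> R[i]) : R := Num.sqrt (fine (sq_int Omega f)).

(* A function on Omega is represented by its extension by 0 to C^n, so that equality
   of elements is equality on Omega. *)
Definition bergman_set (R : realType) n (Omega : set 'rV[R[i]]_n) :
    set ('rV[R[i]]_n -> R[i]) :=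
  [set f | [/\ holomorphic_on Omega f, (sq_int Omega f < +oo)%E &
               forall z, ~ Omega z -> f z = 0]].

Section bergman_facts.
Context (R : realType) (n : nat) (Omega : set 'rV[R[i]]_n).
Context (oOmega : open Omega).
Local Notation T := (measurableTypeR R * measurableTypeR R)%type.
Local Notation D := (@cvec R n @^-1` Omega).
Local Notation mu := (volume R n).
Local Notation normc := (@Normc.normc R).
Implicit Types f g : 'rV[R[i]]_n -> R[i].

Let modulus f : n.-tuple T -> R := (normc \o f \o @cvec R n) \_ D.

Lemma normr_normc (z : R[i]) : `|z| = (normc z)%:C.
Proof. by case: z. Qed.

Lemma normc_ge0 (z : R[i]) : 0 <= normc z.
Proof. by rewrite -lecR -normr_normc; exact: normr_ge0. Qed.

Lemma normc_continuous : continuous (normc : R[i] -> R).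
Proof.
move=> z; apply/(@cvgrPdist_lt R R _ _ (nbhs_filter z)) => e e0.
have e0' : 0 < e%:C :> R[i] by rewrite ltcR.
near=> x; rewrite -ltcR.
have xz : `|z - x| < e%:C by near: x; exact: (@nbhsx_ballx R[i] R[i] z _ e0').
apply: le_lt_trans xz; rewrite [leRHS]normr_normc lecR.
rewrite ler_norml lerNl opprB !lerBlDr -!lecR !rmorphD/= -!normr_normc.
by rewrite -{3}(subrK x z) ler_normD distrC -{1}(subrK z x) ler_normD.
Unshelve. all: by end_near. Qed.

Let mD : measurable D. Proof. exact: open_cvec_measurable. Qed.

Lemma measurable_modulusD f : holomorphic_on Omega f ->
  measurable_fun D (normc \o f \o @cvec R n).
Proof.
move=> hf; apply: (@measurable_cvec_cont _ _ _ (normc \o f)) => // z Omz.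
apply: continuous_comp; last exact: normc_continuous.
exact: (differentiable_continuous (hf z Omz)).
Qed.

Let measurable_modulus f : holomorphic_on Omega f -> measurable_fun setT (modulus f).
Proof.
by move=> hf; apply/(measurable_restrictT _ _).1 => //; exact: measurable_modulusD.
Qed.

Let modulus_ge0 f t : 0 <= modulus f t.
Proof. by rewrite /modulus patchE; case: ifP => // _; exact: normc_ge0. Qed.

Let LnormE f : ('N[mu]_2%:E[EFin \o modulus f] = sq_int Omega f `^ 2^-1)%E.
Proof.
rewrite unlock /Lnorm; congr (_ `^ _)%E.
rewrite /sq_int [RHS]integral_mkcond; apply: eq_integral => t _ /=.
rewrite ger0_norm// patchE /modulus patchE; case: ifP => _.
  by rewrite powR_mulrn// normc_ge0.
by rewrite powR0// pnatr_eq0.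
Qed.

Lemma sq_int_ge0 f : (0 <= sq_int Omega f)%E.
Proof. by apply: integral_ge0 => t _; rewrite lee_fin sqr_ge0. Qed.

Let LnormE_fin f : (sq_int Omega f < +oo)%E ->
  ('N[mu]_2%:E[EFin \o modulus f] = (L2norm Omega f)%:E)%E.
Proof.
move=> foo; rewrite LnormE /L2norm.
have f0 := sq_int_ge0 f.
rewrite -[in LHS](@fineK _ (sq_int Omega f)) ?ge0_fin_numE// poweR_EFin.
by rewrite powR12_sqrt// fine_ge0.
Qed.

Let Lnorm_lty f : ('N[mu]_2%:E[EFin \o modulus f] < +oo -> sq_int Omega f < +oo)%E.
Proof.
rewrite LnormE => h; have := poweR_lty 2 h.
by rewrite -poweRrM mulVf ?pnatr_eq0// poweRe1// sq_int_ge0.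
Qed.

Let measurable_sq (h : n.-tuple T -> R) : measurable_fun setT h ->
  measurable_fun setT (fun t => (`|(EFin \o h) t| `^ 2)%E).
Proof.
move=> mh; apply/(measurable_EFinP _ (fun t => `|h t| `^ 2)).
apply: (measurableT_comp (@measurable_powR R 2)).
exact: measurableT_comp.
Qed.

Let Lnorm_triangle f g : holomorphic_on Omega f -> holomorphic_on Omega g ->
  ('N[mu]_2%:E[EFin \o modulus (f + g)%R] <=
   'N[mu]_2%:E[EFin \o modulus f] + 'N[mu]_2%:E[EFin \o modulus g])%E.
Proof.
move=> hf hg; have mf := measurable_modulus hf; have mg := measurable_modulus hg.
apply: (@le_trans _ _ ('N[mu]_2%:E[EFin \o (modulus f \+ modulus g)%R])%E); last first.
  by apply: minkowski_EFin => //; rewrite ler1n.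
have hfg : holomorphic_on Omega (f + g).
  by move=> z Omz; apply: differentiableD; [exact: hf|exact: hg].
rewrite unlock /Lnorm gt0_ler_poweR ?invr_ge0//.
- by rewrite in_itv/= leey andbT; apply: integral_ge0 => x _; rewrite lee_fin powR_ge0.
- by rewrite in_itv/= leey andbT; apply: integral_ge0 => x _; rewrite lee_fin powR_ge0.
apply: ge0_le_integral => //.
- by move=> x _; rewrite lee_fin powR_ge0.
- apply: (@measurable_sq (modulus (f + g))); exact: measurable_modulus.
- apply: (@measurable_sq (modulus f \+ modulus g)); exact: measurable_funD.
- move=> t _; rewrite lee_fin ge0_ler_powR// ?nnegrE//.
  rewrite !ger0_norm ?addr_ge0// /modulus /= !patchE; case: ifP => _; last by rewrite addr0.
  by rewrite /= -lecR rmorphD/= -!normr_normc ler_normD.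
Qed.

Lemma L2norm_triangle f g : bergman_set Omega f -> bergman_set Omega g ->
  L2norm Omega (f + g) <= L2norm Omega f + L2norm Omega g.
Proof.
move=> [hf foo _] [hg goo _]; have := Lnorm_triangle hf hg.
rewrite (LnormE_fin foo) (LnormE_fin goo) -EFinD => fg.
by move: (fg); rewrite LnormE_fin ?lee_fin// Lnorm_lty// (le_lt_trans fg)// ltry.
Qed.

Lemma bergman_setD f g : bergman_set Omega f -> bergman_set Omega g ->
  bergman_set Omega (f + g).
Proof.
move=> [hf foo f0] [hg goo g0]; split.
- by move=> z Omz; apply: differentiableD; [exact: hf|exact: hg].
- apply: Lnorm_lty; apply: le_lt_trans (Lnorm_triangle hf hg) _.
  by rewrite (LnormE_fin foo) (LnormE_fin goo) -EFinD ltry.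
- by move=> z Omz; rewrite [LHS]/= /GRing.add/= f0// g0// addr0.
Qed.

Lemma sq_intZ (c : R[i]) f : holomorphic_on Omega f ->
  (sq_int Omega (c *: f) = (normc c ^+ 2)%:E * sq_int Omega f)%E.
Proof.
move=> hf; rewrite /sq_int -ge0_integralZl_EFin//; last exact: sqr_ge0.
- by apply: eq_integral => t _; rewrite -EFinM -exprMn -Normc.normcM.
- by move=> t _; rewrite lee_fin sqr_ge0.
- apply/measurable_EFinP; apply: measurable_funX.
  exact: measurable_modulusD.
Qed.

Lemma L2normZ (c : R[i]) f : holomorphic_on Omega f ->
  L2norm Omega (c *: f) = normc c * L2norm Omega f.
Proof.
move=> hf; rewrite /L2norm sq_intZ//.
have -> : fine ((normc c ^+ 2)%:E * sq_int Omega f)%E = normc c ^+ 2 * fine (sq_int Omega f).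
  have := sq_int_ge0 f; case: (sq_int Omega f) => // _.
  have [->|c0] := eqVneq (normc c) 0; first by rewrite expr0n/= mul0e mul0r.
  rewrite gt0_muley; first exact: (esym (mulr0 _)).
  by rewrite lte_fin exprn_gt0// lt_neqAle eq_sym c0 normc_ge0.
by rewrite sqrtrM ?sqr_ge0// sqrtr_sqr ger0_norm// normc_ge0.
Qed.

Lemma bergman_setZ (c : R[i]) f : bergman_set Omega f -> bergman_set Omega (c *: f).
Proof.
move=> [hf foo f0]; split.
- by move=> z Omz; apply: differentiableZ; exact: hf.
- by rewrite sq_intZ// lte_mul_pinfty// lee_fin sqr_ge0.
- by move=> z Omz; rewrite -[LHS]/(c *: f z) f0// scaler0.
Qed.

Lemma bergman_set0 : bergman_set Omega 0.
Proof.
split=> //.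
have -> : sq_int Omega 0 = 0%E.
  apply: integral0_eq => t _.
  by rewrite Normc.normc0 expr0n.
exact: ltry.
Qed.

Lemma L2norm_eq0 f : bergman_set Omega f -> L2norm Omega f = 0 -> f = 0.
Proof.
move=> [hf foo f0] /eqP; rewrite /L2norm sqrtr_eq0 => int0.
have {}int0 : sq_int Omega f = 0%E.
  apply/eqP; rewrite eq_le sq_int_ge0 andbT.
  by rewrite -(@fineK _ (sq_int Omega f)) ?ge0_fin_numE ?sq_int_ge0// lee_fin.
have oW : open (Omega `&` [set z | 0 < normc (f z)]).
  rewrite openE => z [Omz fz].
  apply: filterI; first exact: open_nbhs_nbhs.
  have : nbhs (normc (f z)) [set y | 0 < y].
    by apply: open_nbhs_nbhs; split => //; exact: open_gt.
  by apply: (continuous_comp (differentiable_continuous (hf z Omz))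
    (@normc_continuous _)).
apply/funext => z; apply: contrapT => fz.
have Omz : Omega z by apply: contrapT => /f0.
have fz0 : 0 < normc (f z).
  rewrite lt_neqAle normc_ge0 andbT; apply/eqP => /esym /Normc.eq0_normc.
  exact: fz.
have := open_volume_gt0 oW (ex_intro _ z (conj Omz fz0)).
rewrite lt_neqAle => /andP[/eqP + _]; apply.
have mh : measurable_fun D (fun t => ((normc (f (cvec t))) ^+ 2)%:E).
  by apply/measurable_EFinP; apply: measurable_funX; exact: measurable_modulusD.
have : (\int[mu]_(t in D) `|((normc (f (cvec t))) ^+ 2)%:E| = 0)%E.
  rewrite -[RHS]int0; apply: eq_integral => t _.
  by rewrite abse_EFin ger0_norm ?sqr_ge0.
move=> /(ae_eq_integral_abs mu mD mh)[N [mN N0 sN]].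
apply/esym/(subset_measure0 _ mN _ N0); first exact: open_cvec_measurable.
move=> t [Dt ft]; apply: sN => /= /(_ Dt)/eqP.
by rewrite eqe expf_eq0/= gt_eqF.
Qed.

End bergman_facts.

Section bergman_space.
Context (R : realType) (n : nat) (Omega : set 'rV[R[i]]_n).

(* The proof that Omega is open is an argument because the L^2 norm separates points
   only for such Omega. *)
Definition bergman_pred of open Omega : {pred 'rV[R[i]]_n -> R[i]} :=
  mem (bergman_set Omega).

Context (oOmega : open Omega).

Let bergman_submod_closed : submod_closed (bergman_pred oOmega).
Proof.
split; first by apply: mem_set; exact: bergman_set0.
move=> c f g /set_mem fO /set_mem gO; apply: mem_set.
exact: (bergman_setD oOmega (bergman_setZ oOmega c fO) gO).
Qed.

HB.instance Definition _ :=
  GRing.isSubmodClosed.Build _ _ (bergman_pred oOmega) bergman_submod_closed.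

Record bergman := Bergman {
  bergman_fun :> 'rV[R[i]]_n -> R[i];
  _ : bergman_fun \in bergman_pred oOmega }.

HB.instance Definition _ := [isSub for bergman_fun].
HB.instance Definition _ := [Choice of bergman by <:].
HB.instance Definition _ := [SubChoice_isSubLmodule of bergman by <:].

Lemma bergmanP (f : bergman) : bergman_set Omega f.
Proof. by apply: set_mem; exact: (valP f). Qed.

Definition bergman_norm (f : bergman) : R[i] := (L2norm Omega f)%:C.

Let bergman_normD f g : bergman_norm (f + g) <= bergman_norm f + bergman_norm g.
Proof.
rewrite /bergman_norm -rmorphD lecR.
by apply: L2norm_triangle => //; exact: bergmanP.
Qed.

Let bergman_normZ (c : R[i]) f : bergman_norm (c *: f) = `|c| * bergman_norm f.
Proof.
rewrite /bergman_norm normr_normc -rmorphM/=; congr (_ %:C).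
by apply: L2normZ => //; have [] := bergmanP f.
Qed.

Let bergman_norm_eq0 f : bergman_norm f = 0 -> f = 0.
Proof.
move=> /complexI h; apply: val_inj.
exact: (L2norm_eq0 oOmega (bergmanP f) h).
Qed.

HB.instance Definition _ := Lmodule_isNormed.Build R[i] bergman
  bergman_normD bergman_normZ bergman_norm_eq0.

Lemma bergman_normE (f : bergman) : `|f| = (L2norm Omega f)%:C.
Proof. by []. Qed.

End bergman_space.

Definition compact_operator (K : numFieldType) (V W : normedModType K)
  (A : {linear V -> W}) : Prop :=
  compact (closure (A @` [set x | `|x| < 1])).

(* For D open: upper semicontinuity, values in [-oo, +oo[, and the sub-mean value
   inequality over the circles bounding closed discs of complex lines inside D. *)
Definition plurisubharmonic (R : realType) n (D : set 'rV[R[i]]_n)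
    (u : 'rV[R[i]]_n -> \bar R) : Prop :=
  [/\ forall z, D z -> (u z < +oo)%E,
      forall z, D z -> forall a : R, (u z < a%:E)%E ->
        \forall z' \near z, (u z' < a%:E)%E &
      forall z w, (forall t : R[i], `|t| <= 1 -> D (z + t *: w)) ->
        ((2 * pi)%:E * u z <=
          \int[@lebesgue_measure R]_(x in `[0%R, (2 * pi)%R])
            u (z + (cos x +i* sin x)%C *: w)%R)%E].

(* Existence of a continuous plurisubharmonic exhaustion function. *)
Definition pseudoconvex (R : realType) n (D : set 'rV[R[i]]_n) : Prop :=
  exists u : 'rV[R[i]]_n -> R,
    [/\ {within D, continuous u},
        plurisubharmonic D (fun z => (u z)%:E) &
        forall c : R, compact (closure (D `&` [set z | u z < c])) /\
                      closure (D `&` [set z | u z < c]) `<=` D].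

(* Main.v *)
Require Import Defs.
From HB Require Import structures.
From mathcomp Require Import all_boot all_order all_algebra.
From mathcomp Require Import all_classical all_reals all_analysis.
From mathcomp Require Import measurable_realfun complex.
From mathcomp Require Import ring lra.

Set Implicit Arguments.
Unset Strict Implicit.
Unset Printing Implicit Defensive.

Import Order.TTheory GRing.Theory Num.Theory.
Import numFieldNormedType.Exports.

Local Open Scope classical_set_scope.
Local Open Scope complex_scope.
Local Open Scope ring_scope.

(* Let K be the closure of phi(Omega), a compact subset of Omega. On a neighbourhood of K
   the unit ball of the Bergman space is uniformly bounded (submean value inequality for
   |f|^2) and uniformly Lipschitz (Cauchy estimate for the derivatives), so its image
   consists of bounded functions on Omega that are Lipschitz functions of phi. Along an
   ultrafilter such functions converge pointwise, hence, K being compact, uniformly on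
   Omega; the limit is holomorphic, and the convergence holds in L^2 because Omega has
   finite volume. The one-variable facts come from Goursat's theorem on rectangles, through
   the Cauchy integral over concentric squares: integrating it over the size of the square
   gives area integrals without polar coordinates. *)

(** Holomorphy is pointwise complex differentiability, with no continuity of the derivative, so
    Green's formula does not apply and Goursat's bisection is needed. No integral formula is
    established afterwards. The only fact drawn from Goursat is 4 s |g 0| <= integral of |g| over
    the boundary of the square of half-side s, for g differentiable off 0 and merely continuous at
    0. With g = F ^ 2 it is the submean property, with g = (F z - F 0) / z the Cauchy estimate.
    Evaluating the integral of dz / z would give 2 pi in place of 4, but constants do not matter for
    compactness. In several variables the submean property is iterated one coordinate at a time, as
    the volume is built, while derivatives are bounded along complex lines. Without an integral
    formula, holomorphy of the limit is obtained from partial derivatives: they converge along the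
    ultrafilter because they are bounded, and the Lipschitz estimate for differences of the
    converging functions shows that the limits make up the derivative. *)

(** * Integrals of continuous functions over segments *)

Section segment_integral.
Context (R : realType).
Implicit Types f g : R -> R.

Definition segint f (a b : R) : R := \int[lebesgue_measure]_(x in `[a, b]) f x.

(** Two-sided continuity, also at the end points: this is what differentiability at the points of
    the segment provides, and it passes to subsegments at once. *)
Definition cts_on f (a b : R) := forall x, a <= x <= b -> {for x, continuous f}.

Lemma cts_onS f a b c d : a <= c -> d <= b -> cts_on f a b -> cts_on f c d.
Proof.
move=> ac db h x /andP[cx xd]; apply: h.
by rewrite (le_trans ac)//= (le_trans xd).
Qed.

Lemma cts_on_within f a b : cts_on f a b -> {within `[a, b], continuous f}.
Proof.
by move=> h; apply: continuous_in_subspaceT => x; rewrite inE/= in_itv/=; exact: h.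
Qed.

Lemma cts_on_integrable f a b : cts_on f a b ->
  lebesgue_measure.-integrable `[a, b] (EFin \o f).
Proof.
move=> h; apply: continuous_compact_integrable; first exact: segment_compact.
exact: cts_on_within.
Qed.

Lemma segint_cat f a m b : a <= m -> m <= b -> cts_on f a b ->
  segint f a b = segint f a m + segint f m b.
Proof.
move=> am mb h; apply/eqP; rewrite addrC -subr_eq; apply/eqP.
rewrite /segint Rintegral_itvB ?bnd_simp//; last exact: cts_on_integrable.
apply: Rintegral_itv_obnd_cbnd.
have mb_int : lebesgue_measure.-integrable `[m, b] (EFin \o f).
  by apply: cts_on_integrable; exact: cts_onS h.
apply: (integrableS _ _ _ mb_int) => //.
by apply: subset_itvr; rewrite bnd_simp.
Qed.

Lemma segint_cst a b (k : R) : a <= b -> segint (fun=> k) a b = k * (b - a).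
Proof.
move=> ab; rewrite /segint Rintegral_cst//.
congr (k * _); apply: etrans (_ : fine (lebesgue_measure `[a, b]%classic) = _) => //.
rewrite lebesgue_measure_itv/= lte_fin.
move: ab; rewrite le_eqVlt => /orP[/eqP ->|ab]; first by rewrite ltxx subrr.
by rewrite ab -EFinD.
Qed.

Lemma le_segint f g a b : cts_on f a b -> cts_on g a b ->
  (forall x, a <= x <= b -> f x <= g x) -> segint f a b <= segint g a b.
Proof.
move=> cf cg fg; apply: le_Rintegral => //; try exact: cts_on_integrable.
Qed.

Lemma cts_onB f g a b : cts_on f a b -> cts_on g a b -> cts_on (fun x => f x - g x) a b.
Proof. by move=> cf cg x xab; apply: cvgB; [exact: cf|exact: cg]. Qed.

Lemma cts_onD f g a b : cts_on f a b -> cts_on g a b -> cts_on (fun x => f x + g x) a b.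
Proof. by move=> cf cg x xab; apply: cvgD; [exact: cf|exact: cg]. Qed.

Lemma segintB f g a b : cts_on f a b -> cts_on g a b ->
  segint f a b - segint g a b = segint (fun x => f x - g x) a b.
Proof. by move=> cf cg; rewrite /segint RintegralB//; exact: cts_on_integrable. Qed.

Lemma segintD f g a b : cts_on f a b -> cts_on g a b ->
  segint f a b + segint g a b = segint (fun x => f x + g x) a b.
Proof. by move=> cf cg; rewrite /segint RintegralD//; exact: cts_on_integrable. Qed.

Lemma segint_ge_cst f a b k : a <= b -> cts_on f a b ->
  (forall x, a <= x <= b -> k <= f x) -> k * (b - a) <= segint f a b.
Proof.
move=> ab cf kf; rewrite -segint_cst//; apply: le_segint => // x _.
exact: cst_continuous.
Qed.

Lemma segint_le_cst f a b k : a <= b -> cts_on f a b ->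
  (forall x, a <= x <= b -> f x <= k) -> segint f a b <= k * (b - a).
Proof.
move=> ab cf kf; rewrite -segint_cst//; apply: le_segint => // x _.
exact: cst_continuous.
Qed.

(** Meant for two opposite sides of a rectangle: there the affine approximations of the integrand
    differ by the constant [m], up to a pointwise error. *)
Lemma segint_diff_near f g a b m e : a <= b -> cts_on f a b -> cts_on g a b ->
  (forall x, a <= x <= b -> `|f x - g x - m| <= e) ->
  `|segint f a b - segint g a b - m * (b - a)| <= e * (b - a).
Proof.
move=> ab cf cg h; rewrite segintB// ler_distl -mulrBl -mulrDl.
apply/andP; split.
  apply: segint_ge_cst => //; first exact: cts_onB.
  by move=> x /h; rewrite ler_distl => /andP[].
apply: segint_le_cst => //; first exact: cts_onB.
by move=> x /h; rewrite ler_distl => /andP[].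
Qed.

End segment_integral.

(** * Goursat's theorem on rectangles *)

Section goursat.
Context (R : realType).
Implicit Types U V : R -> R -> R.

(* The imaginary part of the integral of (U + iV)(dx + i dy) along the boundary of
   [a, b] x [c, d]. *)
Definition circ U V (a b c d : R) : R :=
  segint (U b) c d - segint (U a) c d - (segint (V^~ d) a b - segint (V^~ c) a b).

(* U + iV has a complex derivative A + iB at p + iq. *)
Definition cauchy_riemann U V (p q : R) := exists A B : R,
  forall e, 0 < e -> exists2 d, 0 < d & forall x y, `|x - p| < d -> `|y - q| < d ->
    `|U x y - U p q - (A * (x - p) - B * (y - q))| <= e * (`|x - p| + `|y - q|) /\
    `|V x y - V p q - (B * (x - p) + A * (y - q))| <= e * (`|x - p| + `|y - q|).

(** With one coordinate frozen, the linear part is the increment of the other times A, B or -B, so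
    each slice is Lipschitz at the point with constant [k]; the 1 in [k] absorbs the error term
    taken with e = 1. *)
Lemma cauchy_riemann_cts U V p q : cauchy_riemann U V p q ->
  [/\ {for q, continuous (U p)}, {for q, continuous (V p)},
      {for p, continuous (U^~ q)} & {for p, continuous (V^~ q)}].
Proof.
move=> [A [B /(_ 1 ltr01)[d d0 h]]].
pose k := `|A| + `|B| + 1.
have k0 : 0 < k by rewrite /k ltr_wpDl// addr_ge0.
have bd (r x t z w s : R) : `|z - r - w| <= s -> w = x * t -> s = `|t| ->
    `|x| <= `|A| + `|B| -> `|r - z| <= k * `|t|.
  move=> zt wE sE xAB; rewrite distrC -(subrK w (z - r)).
  apply: le_trans (ler_normD _ _) _; rewrite wE normrM /k mulrDl mul1r addrC.
  by rewrite -wE -sE lerD// sE ler_wpM2r.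
have cv (f : R -> R) r : (forall t, `|t - r| < d -> `|f r - f t| <= k * `|t - r|) ->
    {for r, continuous f}.
  move=> hf; apply/cvgrPdist_lt => e e0; near=> t.
  have tr : `|t - r| < Num.min d (e / k).
    rewrite distrC; near: t; apply: (@cvgr_dist_lt _ R^o _ (nbhs r)) => //.
    by rewrite lt_min d0 divr_gt0.
  move: tr; rewrite lt_min => /andP[td te].
  by apply: le_lt_trans (hf _ td) _; rewrite mulrC -ltr_pdivlMr.
split; apply: cv => t td.
- have := h p t; rewrite subrr normr0 => /(_ d0 td)[h1 _].
  by apply: (bd _ (- B) _ _ _ _ h1); [ring|ring|rewrite normrN lerDr].
- have := h p t; rewrite subrr normr0 => /(_ d0 td)[_ h1].
  by apply: (bd _ A _ _ _ _ h1); [ring|ring|rewrite lerDl].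
- have := h t q; rewrite subrr normr0 => /(_ td d0)[h1 _].
  by apply: (bd _ A _ _ _ _ h1); [ring|ring|rewrite lerDl].
- have := h t q; rewrite subrr normr0 => /(_ td d0)[_ h1].
  by apply: (bd _ B _ _ _ _ h1); [ring|ring|rewrite lerDr].
Unshelve. all: by end_near. Qed.

Lemma circ_vcut U V a m b c d : a <= m -> m <= b ->
  cts_on (V^~ c) a b -> cts_on (V^~ d) a b ->
  circ U V a b c d = circ U V a m c d + circ U V m b c d.
Proof. by move=> am mb cc cd; rewrite /circ !(segint_cat am mb)//; ring. Qed.

Lemma circ_hcut U V a b c m d : c <= m -> m <= d ->
  cts_on (U a) c d -> cts_on (U b) c d ->
  circ U V a b c d = circ U V a b c m + circ U V a b m d.
Proof. by move=> am mb cc cd; rewrite /circ !(segint_cat am mb)//; ring. Qed.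

(** A is both dU/dx and dV/dy, so the affine part contributes A (b - a) (d - c) to the vertical
    sides and the same to the horizontal ones, and cancels. What remains is the approximation error,
    at most e / 2 times the half-perimeter L at each boundary point, integrated over sides of total
    half-length L. *)
Lemma circ_local U V p q e : 0 < e -> cauchy_riemann U V p q ->
  exists2 r, 0 < r & forall a b c d, a <= p <= b -> c <= q <= d ->
    b - a < r -> d - c < r ->
    cts_on (U a) c d -> cts_on (U b) c d -> cts_on (V^~ c) a b -> cts_on (V^~ d) a b ->
    `|circ U V a b c d| <= e * (b - a + (d - c)) ^+ 2.
Proof.
move=> e0 [A [B h]].
have [|r r0 {}h] := h (e / 2); first by rewrite divr_gt0.
exists r => // a b c d /andP[ap pb] /andP[cq qd] bar dcr cUa cUb cVc cVd.
have ab := le_trans ap pb; have cd := le_trans cq qd.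
set L := b - a + (d - c).
have near_p x : a <= x <= b -> `|x - p| <= b - a.
  by move=> /andP[ax xb]; rewrite ler_norml; lra.
have near_q y : c <= y <= d -> `|y - q| <= d - c.
  by move=> /andP[cy yd]; rewrite ler_norml; lra.
have H x y : a <= x <= b -> c <= y <= d ->
    `|U x y - U p q - (A * (x - p) - B * (y - q))| <= e / 2 * L /\
    `|V x y - V p q - (B * (x - p) + A * (y - q))| <= e / 2 * L.
  move=> xab ycd; have xp := near_p _ xab; have yq := near_q _ ycd.
  have [h1 h2] := h x y (le_lt_trans xp bar) (le_lt_trans yq dcr).
  have le : e / 2 * (`|x - p| + `|y - q|) <= e / 2 * L.
    by rewrite ler_wpM2l ?lerD// divr_ge0// ltW.
  by split; [exact: le_trans h1 le|exact: le_trans h2 le].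
have D (s t u v : R) : `|s - u| <= e / 2 * L -> `|t - v| <= e / 2 * L ->
    `|s - t - (u - v)| <= e * L.
  move=> su tv; have -> : s - t - (u - v) = (s - u) - (t - v) by ring.
  by apply: le_trans (ler_normB _ _) _; rewrite {su tv}(le_trans (lerD su tv))//; lra.
have IU : `|segint (U b) c d - segint (U a) c d - A * (b - a) * (d - c)| <= e * L * (d - c).
  apply: segint_diff_near => // y ycd.
  have [+ _] := H b y (introT andP (conj ab (lexx _))) ycd.
  have [+ _] := H a y (introT andP (conj (lexx _) ab)) ycd.
  move=> /[swap] h1 /(D _ _ _ _ h1); set X := `|_|; set Y := `|_|.
  by rewrite (_ : X = Y)//; congr `|_|; ring.
have IV : `|segint (V^~ d) a b - segint (V^~ c) a b - A * (d - c) * (b - a)| <= e * L * (b - a).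
  apply: segint_diff_near => // x xab.
  have [_ +] := H x d xab (introT andP (conj cd (lexx _))).
  have [_ +] := H x c xab (introT andP (conj (lexx _) cd)).
  move=> /[swap] h1 /(D _ _ _ _ h1); set X := `|_|; set Y := `|_|.
  by rewrite (_ : X = Y)//; congr `|_|; ring.
have -> : circ U V a b c d =
  (segint (U b) c d - segint (U a) c d - A * (b - a) * (d - c)) -
  (segint (V^~ d) a b - segint (V^~ c) a b - A * (d - c) * (b - a)).
  by rewrite /circ; ring.
apply: le_trans (ler_normB _ _) _; rewrite (le_trans (lerD IU IV))//.
by rewrite -mulrDr addrC -/L expr2 mulrA.
Qed.

Lemma nested_segments (x : nat -> R) (w : R) : 0 <= w ->
  (forall k, x k <= x k.+1 /\ x k.+1 + w / 2 ^+ k.+1 <= x k + w / 2 ^+ k) ->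
  exists p, forall k, x k <= p <= x k + w / 2 ^+ k.
Proof.
move=> w0 h.
have xh : {homo x : k l / (k <= l)%N >-> k <= l}.
  apply: homo_leq => //; first exact: le_trans.
  by move=> k; have [] := h k.
have yh : {homo (fun k => x k + w / 2 ^+ k) : k l / (k <= l)%N >-> l <= k}.
  apply: (homo_leq (r := fun k l => l <= k)) => //.
    by move=> s t u st tu; exact: le_trans tu st.
  by move=> k; have [] := h k.
have ub k : ubound (range x) (x k + w / 2 ^+ k).
  move=> _ [l _ <-]; apply: le_trans (xh _ _ (leq_maxl l k)) _.
  apply: le_trans (yh _ _ (leq_maxr l k)).
  by rewrite lerDl divr_ge0// exprn_ge0.
exists (sup (range x)) => k; apply/andP; split.
  apply: ub_le_sup; first by exists (x 0%N + w / 2 ^+ 0); exact: ub.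
  by exists k.
by apply: ge_sup => //; exists (x 0%N); exists 0%N.
Qed.

(** Quartering keeps the lower left corner or shifts it by half a side, so only corners are tracked,
    the size at stage [k] being known. [P] is the property handed down to a well-chosen quarter. *)
Lemma nested_rectangles (P : nat -> R -> R -> Prop) (a c w h : R) :
  0 <= w -> 0 <= h -> P 0%N a c ->
  (forall k x y, P k x y -> exists x' y', [/\ P k.+1 x' y',
     x' = x \/ x' = x + w / 2 ^+ k.+1 & y' = y \/ y' = y + h / 2 ^+ k.+1]) ->
  exists p q, forall k, exists x y,
    [/\ P k x y, x <= p <= x + w / 2 ^+ k & y <= q <= y + h / 2 ^+ k].
Proof.
move=> w0 h0 P0 PS.
pose next k s t := [/\ P k.+1 t.1 t.2, t.1 = s.1 \/ t.1 = s.1 + w / 2 ^+ k.+1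
  & t.2 = s.2 \/ t.2 = s.2 + h / 2 ^+ k.+1].
(* The implication makes the choice total; [Ps] then supplies its premise along the whole
   sequence. *)
have step k (s : R * R) : {t : R * R | P k s.1 s.2 -> next k s t}.
  apply: cid; have [/PS[x [y H]]|nP] := pselect (P k s.1 s.2).
    by exists (x, y).
  by exists s.
pose s := fix s k := if k is l.+1 then sval (step l (s l)) else (a, c).
have Ps k : P k (s k).1 (s k).2.
  by elim: k => //= k; case: (step k (s k)) => /= t h1 /h1 [].
have sS k : next k (s k) (s k.+1) by have := svalP (step k (s k)); exact.
have half (u : R) k : u / 2 ^+ k = u / 2 ^+ k.+1 + u / 2 ^+ k.+1.
  by rewrite exprS; field; rewrite expf_neq0.
have [p pP] : exists p, forall k, (s k).1 <= p <= (s k).1 + w / 2 ^+ k.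
  apply: nested_segments => // k; have [_ + _] := sS k.
  have : 0 <= w / 2 ^+ k.+1 by rewrite divr_ge0// exprn_ge0.
  by rewrite (half w k) => wk [|] ->; lra.
have [q qP] : exists q, forall k, (s k).2 <= q <= (s k).2 + h / 2 ^+ k.
  apply: nested_segments => // k; have [_ _] := sS k.
  have : 0 <= h / 2 ^+ k.+1 by rewrite divr_ge0// exprn_ge0.
  by rewrite (half h k) => hk [|] ->; lra.
by exists p, q => k; exists (s k).1, (s k).2; split.
Qed.

(* Otherwise quartering yields nested rectangles on which |circ| is bounded below by a
   constant times the square of the side lengths, contradicting [circ_local] at their
   common point. *)
Lemma circ_eq0 U V a b c d : a <= b -> c <= d ->
  (forall p q, a <= p <= b -> c <= q <= d -> cauchy_riemann U V p q) ->
  circ U V a b c d = 0.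
Proof.
move=> ab cd CR.
set w := b - a; set h := d - c.
have w0 : 0 <= w by rewrite subr_ge0.
have h0 : 0 <= h by rewrite subr_ge0.
have cU x y y' : a <= x <= b -> c <= y -> y' <= d -> cts_on (U x) y y'.
  move=> xab cy yd t /andP[yt ty'].
  have tcd : c <= t <= d by rewrite (le_trans cy yt) (le_trans ty' yd).
  by have [] := cauchy_riemann_cts (CR x t xab tcd).
have cV x x' y : c <= y <= d -> a <= x -> x' <= b -> cts_on (V^~ y) x x'.
  move=> ycd ax xb t /andP[xt tx'].
  have tab : a <= t <= b by rewrite (le_trans ax xt) (le_trans tx' xb).
  by have [] := cauchy_riemann_cts (CR t y tab ycd).
set D := `|circ U V a b c d|.
pose W k : R := w / 2 ^+ k; pose H k : R := h / 2 ^+ k.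
have half (u : R) k : u / 2 ^+ k = u / 2 ^+ k.+1 + u / 2 ^+ k.+1.
  by rewrite exprS; field; rewrite expf_neq0.
have W0 k : 0 <= W k by rewrite divr_ge0// exprn_ge0.
have H0 k : 0 <= H k by rewrite divr_ge0// exprn_ge0.
pose P k x y := [/\ a <= x /\ x + W k <= b, c <= y /\ y + H k <= d &
  D / 4 ^+ k <= `|circ U V x (x + W k) y (y + H k)|].
have [] := @nested_rectangles P a c w h w0 h0.
- rewrite /P /W /H expr0 !divr1 /w /h; split; [lra|lra|].
  by rewrite /D !(addrC _ (_ - _)) !subrK.
- move=> k x y [[ax xb] [cy yd] Dk].
  have Wk := half w k; have Hk := half h k; rewrite -/(W _) -/(W _) in Wk.
  rewrite -/(H _) -/(H _) in Hk.
  set x1 := x + W k.+1; set y1 := y + H k.+1.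
  have xE : x + W k = x1 + W k.+1 by rewrite Wk addrA.
  have yE : y + H k = y1 + H k.+1 by rewrite Hk addrA.
  rewrite {}xE in xb Dk; rewrite {}yE in yd Dk.
  have xx1 : x <= x1 by rewrite lerDl.
  have x1x2 : x1 <= x1 + W k.+1 by rewrite lerDl.
  have yy1 : y <= y1 by rewrite lerDl.
  have y1y2 : y1 <= y1 + H k.+1 by rewrite lerDl.
  have ax1 := le_trans ax xx1; have x1b := le_trans x1x2 xb.
  have cy1 := le_trans cy yy1; have y1d := le_trans y1y2 yd.
  have xab : a <= x <= b by rewrite ax (le_trans xx1).
  have x1ab : a <= x1 <= b by rewrite ax1.
  have x2ab : a <= x1 + W k.+1 <= b by rewrite xb (le_trans ax1).
  have ycd : c <= y <= d by rewrite cy (le_trans yy1).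
  have y2cd : c <= y1 + H k.+1 <= d by rewrite yd (le_trans cy1).
  have E : circ U V x (x1 + W k.+1) y (y1 + H k.+1) =
    circ U V x x1 y y1 + circ U V x x1 y1 (y1 + H k.+1) +
    (circ U V x1 (x1 + W k.+1) y y1 + circ U V x1 (x1 + W k.+1) y1 (y1 + H k.+1)).
    rewrite (@circ_vcut U V x x1 (x1 + W k.+1))//; [|exact: cV|exact: cV].
    by congr (_ + _); apply: circ_hcut => //; exact: cU.
  rewrite {}E in Dk.
  have [h1|h1] := leP (D / 4 ^+ k.+1) `|circ U V x x1 y y1|.
    by exists x, y; split; [split|left|left].
  have [h2|h2] := leP (D / 4 ^+ k.+1) `|circ U V x x1 y1 (y1 + H k.+1)|.
    by exists x, y1; split; [split|left|right].
  have [h3|h3] := leP (D / 4 ^+ k.+1) `|circ U V x1 (x1 + W k.+1) y y1|.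
    by exists x1, y; split; [split|right|left].
  have [h4|h4] := leP (D / 4 ^+ k.+1) `|circ U V x1 (x1 + W k.+1) y1 (y1 + H k.+1)|.
    by exists x1, y1; split; [split|right|right].
  move: Dk; rewrite leNgt => /negP[].
  apply: le_lt_trans (ler_normD _ _) _.
  apply: le_lt_trans (lerD (ler_normD _ _) (ler_normD _ _)) _.
  have -> : D / 4 ^+ k =
      D / 4 ^+ k.+1 + D / 4 ^+ k.+1 + (D / 4 ^+ k.+1 + D / 4 ^+ k.+1).
    by rewrite exprS; field; rewrite expf_neq0.
  exact: ltrD (ltrD h1 h2) (ltrD h3 h4).
move=> p [q pq].
have [x0 [y0 [[[ax0 xb0] [cy0 yd0] _] /andP[xp0 px0] /andP[yq0 qy0]]]] := pq 0%N.
have pab : a <= p <= b.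
  by move: px0 xb0; rewrite /W expr0 divr1 => ? ?; apply/andP; lra.
have qcd : c <= q <= d.
  by move: qy0 yd0; rewrite /H expr0 divr1 => ? ?; apply/andP; lra.
apply/eqP; rewrite -normr_le0 -/D; apply/ler_addgt0Pr => e e0; rewrite add0r.
have wh0 : 0 <= w + h by rewrite addr_ge0.
(* At stage k the half-perimeter is (w + h) / 2 ^ k, so the local bound e' (w + h) ^ 2 / 4 ^ k and
   the lower bound D / 4 ^ k scale alike. The + 1 covers w + h = 0. *)
pose e' := e / ((w + h) ^+ 2 + 1).
have N0 : 0 < (w + h) ^+ 2 + 1 by rewrite ltr_wpDl// sqr_ge0.
have e'0 : 0 < e' by rewrite divr_gt0.
have [r r0 hr] := circ_local e'0 (CR p q pab qcd).
have [k kr] : exists k, (w + h) / 2 ^+ k < r.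
  have wh1 : 0 < w + h + 1 by rewrite ltr_wpDl.
  have [k] := ltr_add_invr (divr_gt0 r0 wh1).
  rewrite add0r ltr_pdivlMr// => hk; exists k.
  apply: le_lt_trans hk; rewrite mulrC.
  apply: ler_pM => //; last by rewrite lerDl.
  rewrite lef_pV2 ?posrE ?exprn_gt0//.
  by rewrite -natrX ler_nat ltn_expl.
have [x [y [[[ax xb] [cy yd] Dk] xp yq]]] := pq k.
have WH : W k + H k = (w + h) / 2 ^+ k by rewrite -mulrDl.
rewrite -/(W k) in xp; rewrite -/(H k) in yq; rewrite -WH in kr.
move: (W0 k) (H0 k) => Wk0 Hk0.
move: (W k) (H k) Wk0 Hk0 WH ax xb cy yd Dk xp yq kr.
clear -e' N0 e0 e'0 hr cU cV => u v u0 v0 WH ax xb cy yd Dk xp yq kr.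
have ux : x <= x + u by rewrite lerDl.
have vy : y <= y + v by rewrite lerDl.
have xab : a <= x <= b by rewrite ax (le_trans ux).
have xuab : a <= x + u <= b by rewrite xb (le_trans ax).
have ycd : c <= y <= d by rewrite cy (le_trans vy).
have yvcd : c <= y + v <= d by rewrite yd (le_trans cy).
have : D / 4 ^+ k <= e' * (u + v) ^+ 2.
  apply: le_trans Dk _.
  have := hr x (x + u) y (y + v) xp yq.
  rewrite (_ : x + u - x = u); last by ring.
  rewrite (_ : y + v - y = v); last by ring.
  apply; [by apply: le_lt_trans kr; rewrite lerDl|by apply: le_lt_trans kr; rewrite lerDr|
    exact: cU|exact: cU|exact: cV|exact: cV].
rewrite WH expr_div_n -exprM mulnC exprM (_ : 2 ^+ 2 = 4 :> R); last by ring.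
rewrite mulrA ler_pM2r ?invr_gt0 ?exprn_gt0// => /le_trans; apply.
by rewrite /e' mulrAC ler_pdivrMr// ler_pM2l// lerDl.
Qed.

End goursat.

(** * Independence of the boundary integral from the size of the square *)

Section annulus.
Context (R : realType).
Implicit Types U V : R -> R -> R.

Lemma segintZ (f : R -> R) k a b : cts_on f a b ->
  segint (fun x => k * f x) a b = k * segint f a b.
Proof. by move=> cf; rewrite /segint RintegralZl//; exact: cts_on_integrable. Qed.

(** Cuts along x = -r, x = r, y = -r and y = r peel four rectangles off the large square, and on
    each of them [circ_eq0] applies. *)
Lemma circ_annulus U V (r s : R) : 0 < r -> r <= s ->
  (forall p q, `|p| <= s -> `|q| <= s -> r <= `|p| \/ r <= `|q| ->
    cauchy_riemann U V p q) ->
  circ U V (- s) s (- s) s = circ U V (- r) r (- r) r.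
Proof.
move=> r0 rs CR; have s0 : 0 < s by exact: lt_le_trans rs.
have ns (p : R) : - s <= p <= s -> `|p| <= s by rewrite ler_norml.
have rn (p : R) : r <= p -> r <= `|p| by move=> h; apply: le_trans h (ler_norm _).
have rN (p : R) : p <= - r -> r <= `|p|.
  by rewrite lerNr => h; apply: le_trans h _; rewrite -normrN ler_norm.
have cU p : - s <= p <= s -> r <= `|p| -> cts_on (U p) (- s) s.
  move=> ps pr t /ns ts.
  by have [] := cauchy_riemann_cts (CR p t (ns _ ps) ts (or_introl pr)).
have cV q : - s <= q <= s -> r <= `|q| -> cts_on (V^~ q) (- s) s.
  move=> qs qr t /ns ts.
  by have [] := cauchy_riemann_cts (CR t q ts (ns _ qs) (or_intror qr)).
have Ns : - s <= - r by rewrite lerN2.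
have Nr : - r <= r by lra.
have sN : - r <= s := le_trans Nr rs.
have Nrs : - s <= r := le_trans Ns Nr.
have ss : - s <= s := le_trans Nrs rs.
have iNs : - s <= - s <= s by rewrite lexx.
have is_ : - s <= s <= s by rewrite lexx andbT.
have iNr : - s <= - r <= s by rewrite Ns.
have ir : - s <= r <= s by rewrite Nrs.
have rNs : r <= `|- s| by rewrite normrN rn.
have rs' : r <= `|s| by exact: rn.
have rNr : r <= `|- r| by exact: rN.
have rr : r <= `|r| by exact: rn.
have z1 a b c d : - s <= a -> a <= b -> b <= s -> - s <= c -> c <= d -> d <= s ->
    r <= a \/ b <= - r \/ r <= c \/ d <= - r -> circ U V a b c d = 0.
  move=> sa ab bs sc cd ds H; apply: circ_eq0 => // p q /andP[ap pb] /andP[cq qd].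
  apply: CR.
  - by apply: ns; rewrite (le_trans sa)// (le_trans pb).
  - by apply: ns; rewrite (le_trans sc)// (le_trans qd).
  - case: H => [H|[H|[H|H]]]; [left; apply: rn|left; apply: rN|right; apply: rn|right; apply: rN].
    + exact: le_trans H ap.
    + exact: le_trans pb H.
    + exact: le_trans H cq.
    + exact: le_trans qd H.
rewrite (@circ_vcut R U V (- s) (- r) s)//; [|exact: cV|exact: cV].
rewrite [X in X + _]z1//; last by right; left.
rewrite add0r (@circ_vcut R U V (- r) r s)//; last 2 first.
- by apply: cts_onS (cV _ _ _).
- by apply: cts_onS (cV _ _ _).
rewrite [X in _ + X]z1//; last by left.
rewrite addr0 (@circ_hcut R U V (- r) r (- s) (- r) s)//; [|exact: cU|exact: cU].
rewrite [X in X + _]z1//; last by right; right; right.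
rewrite add0r (@circ_hcut R U V (- r) r (- r) r s)//; last 2 first.
- by apply: cts_onS (cU _ _ _).
- by apply: cts_onS (cU _ _ _).
by rewrite [X in _ + X]z1 ?addr0//; right; right; left.
Qed.

End annulus.

(** * Complex moduli and complex differentials *)

Section complex_norm.
Context (R : realType).
Local Notation normc := (@Normc.normc R).
Implicit Types (z w : R[i]).

Lemma normc_real (a : R) : normc a%:C = `|a|.
Proof. by apply/(@complexI R); rewrite -normr_normc normc_def /= expr0n addr0 sqrtr_sqr. Qed.

Lemma abs_Re_normc z : `|complex.Re z| <= normc z.
Proof. by rewrite -lecR -normr_normc normc_ge_Re. Qed.

Lemma abs_Im_normc z : `|complex.Im z| <= normc z.
Proof.
case: z => a b /=; rewrite -sqrtr_sqr ler_wsqrtr// lerDr sqr_ge0//.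
Qed.

Lemma normc_le_ReIm (a b : R) : normc (a +i* b) <= `|a| + `|b|.
Proof. by rewrite -lecR -normr_normc normc_leD. Qed.

Lemma exists_rotation w : exists u : R[i], normc u = 1 /\ u * w = (normc w)%:C.
Proof.
have [->|w0] := eqVneq w 0.
  by exists 1; rewrite Normc.normc1 mulr0 Normc.normc0.
have Gn : `|w| != 0 by rewrite normr_eq0.
exists (w^-1 * (normc w)%:C); rewrite mulrAC mulVf// mul1r; split=> //.
rewrite Normc.normcM Normc.normcV normc_real ger0_norm ?normc_ge0// mulVf//.
by apply: contra Gn; rewrite normr_normc => /eqP ->.
Qed.

(** Radii of balls live in [R[i]]; real radii suffice, so epsilon-delta arguments can be carried out
    in [R]. *)
Lemma near_normP (V : normedModType R[i]) (z : V) (P : set V) :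
  (\forall y \near z, P y) <-> exists2 d : R, 0 < d & forall y, `|y - z| < d%:C -> P y.
Proof.
split=> [/nbhs_normP[e /= e0 eP]|[d d0 dP]].
  have er : (complex.Re e)%:C = e by rewrite RRe_real// gtr0_real.
  exists (complex.Re e); first by rewrite -ltcR er.
  by move=> y; rewrite er => yz; apply: eP; rewrite /= distrC.
apply/nbhs_normP; exists d%:C; first by rewrite /= ltcR.
by move=> y /=; rewrite distrC; exact: dP.
Qed.

Lemma differentiable_eps (V W : normedModType R[i]) (f : V -> W) (z : V) :
  differentiable f z -> forall e : R, 0 < e -> exists2 d : R, 0 < d &
    forall h, `|h| < d%:C -> `|f (z + h) - f z - 'd f z h| <= e%:C * `|h|.
Proof.
move=> /diff_locally/eqaddoP h e e0.
have e0' : 0 < e%:C :> R[i] by rewrite ltcR.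
have /near_normP[d d0 dP] := h _ e0'.
exists d => // y yd; have := dP y; rewrite subr0 => /(_ yd).
rewrite [X in `|X| <= _](_ : _ = f (z + y) - f z - 'd f z y)//=.
by rewrite !fctE/= opprD addrA (addrC y).
Qed.

Lemma eps_differentiable (V W : normedModType R[i]) (f : V -> W) (z : V) (L : {linear V -> W}) :
  continuous L -> (forall e : R, 0 < e -> exists2 d : R, 0 < d &
    forall h, `|h| < d%:C -> `|f (z + h) - f z - L h| <= e%:C * `|h|) ->
  differentiable f z.
Proof.
move=> cL h.
have E : f \o shift z = cst (f z) + L +o_ 0 id.
  apply/eqaddoP => e e0.
  have er : (complex.Re e)%:C = e by rewrite RRe_real// gtr0_real.
  have e0' : 0 < complex.Re e by rewrite -ltcR er.
  have [d d0 dP] := h _ e0'.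
  apply/near_normP; exists d => // y; rewrite subr0 => /dP.
  rewrite er [X in _ -> `|X| <= _](_ : _ = f (z + y) - f z - L y)//=.
  by rewrite !fctE/= opprD addrA (addrC y).
apply/diff_locallyP; rewrite (diff_unique cL E); split=> //.
Qed.

Lemma holomorphic_cauchy_riemann (F : R[i] -> R[i]) (p q : R) :
  differentiable F (p +i* q) ->
  cauchy_riemann (fun x y => complex.Re (F (x +i* y))) (fun x y => complex.Im (F (x +i* y))) p q.
Proof.
move=> dF; pose D := 'd F (p +i* q) 1.
(* Complex linearity turns the differential into multiplication by D, whose real and imaginary parts
   are the A and B of [cauchy_riemann]. *)
have DE h : 'd F (p +i* q) h = h * D.
  by rewrite -[in LHS](mulr1 h) -[h * 1]/(h *: (1 : R[i]^o)) linearZ.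
exists (complex.Re D), (complex.Im D) => e e0.
have [d d0 dP] := differentiable_eps dF e0.
exists (d / 2); first by rewrite divr_gt0.
move=> x y xp yq.
have hle : normc ((x - p) +i* (y - q)) <= `|x - p| + `|y - q| by exact: normc_le_ReIm.
have := dP ((x - p) +i* (y - q)); rewrite DE normr_normc ltcR => /(_ _)/wrap[].
  by apply: le_lt_trans hle _; rewrite (splitr d) ltrD.
have -> : (p +i* q) + ((x - p) +i* (y - q)) = x +i* y :> R[i].
  by apply/eqP; rewrite eq_complex /= !addrA !(addrC _ (- _)) !addKr !eqxx.
rewrite normr_normc -rmorphM lecR => H.
have {}H := le_trans H (ler_wpM2l (ltW e0) hle).
split; apply: le_trans H.
  apply: le_trans (abs_Re_normc _); rewrite le_eqVlt; apply/orP; left; apply/eqP; congr `|_|.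
  by case: (F (x +i* y)) => ? ?; case: (F (p +i* q)) => ? ?; case: D {DE} => ? ? /=; ring.
apply: le_trans (abs_Im_normc _); rewrite le_eqVlt; apply/orP; left; apply/eqP; congr `|_|.
by case: (F (x +i* y)) => ? ?; case: (F (p +i* q)) => ? ?; case: D {DE} => ? ? /=; ring.
Qed.

End complex_norm.

(** * A mean value inequality on squares *)

Section square_mean.
Context (R : realType).
Local Notation normc := (@Normc.normc R).
Implicit Types (z w : R[i]) (g : R[i] -> R[i]).

Lemma continuous_complex (T : topologicalType) (a b : T -> R) t :
  {for t, continuous a} -> {for t, continuous b} ->
  {for t, continuous (fun s => a s +i* b s : R[i])}.
Proof.
move=> ca cb; apply/cvgrPdist_lt => e e0.
have er : (complex.Re e)%:C = e by rewrite RRe_real// gtr0_real.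
have {e0} : 0 < complex.Re e / 2 by rewrite divr_gt0// -ltcR er.
move=> e0; move/cvgrPdist_lt: ca => /(_ _ e0) na; move/cvgrPdist_lt: cb => /(_ _ e0) nb.
near=> s; rewrite -er normr_normc ltcR.
apply: le_lt_trans (normc_le_ReIm _ _) _; rewrite (splitr (complex.Re e)) ltrD//.
  by near: s.
by near: s.
Unshelve. all: by end_near. Qed.

(** Integrated over t in [-r, r], this is the arc length integral of [h] over the boundary of the
    square. *)
Definition sides (h : R[i] -> R) (r t : R) : R :=
  h (r +i* t) + h ((- r) +i* t) + h (t +i* r) + h (t +i* (- r)).

Definition in_square (r : R) z := `|complex.Re z| <= r /\ `|complex.Im z| <= r.

Lemma cts_on_sides (h : R[i] -> R) r : 0 < r ->
  (forall z, in_square r z -> z != 0 -> {for z, continuous h}) ->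
  [/\ cts_on (fun t => h (r +i* t)) (- r) r, cts_on (fun t => h ((- r) +i* t)) (- r) r,
      cts_on (fun t => h (t +i* r)) (- r) r & cts_on (fun t => h (t +i* (- r))) (- r) r].
Proof.
move=> r0 ch; have rE : `|r| = r by rewrite gtr0_norm.
have rn : r != 0 by rewrite gt_eqF.
have H (a b : R -> R) : (forall t, {for t, continuous a}) -> (forall t, {for t, continuous b}) ->
    (forall t, - r <= t <= r -> in_square r (a t +i* b t) /\ (a t +i* b t != 0 :> R[i])) ->
    cts_on (fun t => h (a t +i* b t)) (- r) r.
  move=> ca cb ab t /ab[sq n0]; apply: (@continuous_comp _ _ _ (fun t => a t +i* b t : R[i]) h).
    exact: continuous_complex.
  exact: ch.
have cc (k t : R) : {for t, continuous (fun=> k)} by exact: (@cvg_cst R).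
have ci (t : R) : {for t, continuous (fun x : R => x)} by exact: cvg_id.
split; apply: H => // t; rewrite -ler_norml => tr; (split;
  [by split; rewrite /= ?normrN ?rE|rewrite eq_complex /= ?oppr_eq0 (negbTE rn) ?andbF//]).
Qed.

Lemma circ_sides (F : R[i] -> R[i]) (r : R) : 0 < r ->
  (forall z, in_square r z -> z != 0 -> differentiable F z) ->
  let f t := complex.Re (F (r +i* t)) - complex.Re (F ((- r) +i* t))
    - complex.Im (F (t +i* r)) + complex.Im (F (t +i* (- r))) in
  cts_on f (- r) r /\
  circ (fun x y => complex.Re (F (x +i* y))) (fun x y => complex.Im (F (x +i* y)))
    (- r) r (- r) r = segint f (- r) r.
Proof.
move=> r0 dF f.
have cRe : continuous (@complex.Re R).
  move=> z; apply/(@cvgrPdist_lt R R _ _ (nbhs_filter z)) => e e0.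
  apply/near_normP; exists e => // y yz.
  have : `|complex.Re (y - z)| < e.
    by apply: le_lt_trans (abs_Re_normc _) _; rewrite -ltcR -normr_normc.
  by rewrite distrC; case: y {yz} => ? ?; case: z.
have cIm : continuous (@complex.Im R).
  move=> z; apply/(@cvgrPdist_lt R R _ _ (nbhs_filter z)) => e e0.
  apply/near_normP; exists e => // y yz.
  have : `|complex.Im (y - z)| < e.
    by apply: le_lt_trans (abs_Im_normc _) _; rewrite -ltcR -normr_normc.
  by rewrite distrC; case: y {yz} => ? ?; case: z.
have cF z : in_square r z -> z != 0 -> {for z, continuous F}.
  by move=> sq z0; apply: differentiable_continuous; exact: dF.
have [||c1 c2 _ _] := @cts_on_sides (fun z => complex.Re (F z)) r => //.
  by move=> z sq z0; apply: continuous_comp; [exact: cF|exact: cRe].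
have [||_ _ c3 c4] := @cts_on_sides (fun z => complex.Im (F z)) r => //.
  by move=> z sq z0; apply: continuous_comp; [exact: cF|exact: cIm].
have c12 := cts_onB c1 c2; have c123 := cts_onB c12 c3.
split; first exact: cts_onD.
rewrite /circ /f -segintD// -segintB// -segintB//.
by rewrite opprB addrA addrAC -addrA.
Qed.

(** [o] is the outward unit normal of a side: there dz = i o ds, so Im (F dz) = Re (o F) ds, and Re
    (o conj z) = r is the distance from 0 to the line of the side. Writing w = G + (w - G), the
    first part of w / z contributes G r / |z| ^ 2 >= G / (2 r), the second at most e / r in absolute
    value. *)
Lemma side_lower (o z w : R[i]) (G e r : R) : 0 < r -> normc o = 1 ->
  complex.Re (o * z^*%C) = r -> normc z ^+ 2 <= 2 * r ^+ 2 -> r <= normc z ->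
  0 <= G -> normc (w - G%:C) <= e ->
  G / (2 * r) - e / r <= complex.Re (o * (w / z)).
Proof.
move=> r0 o1 oz zr rz G0 we.
set N := normc z.
have N0 : 0 < N by exact: lt_le_trans rz.
have zV : z^-1 = (N ^- 2)%:C * z^*%C.
  by rewrite invc_norm normr_normc -/N fmorphV rmorphXn.
have -> : o * (w / z) = (G / N ^+ 2)%:C * (o * z^*%C) + o * ((w - G%:C) / z).
  by rewrite zV rmorphM/=; ring.
rewrite raddfD /= (_ : complex.Re ((G / N ^+ 2)%:C * (o * z^*%C)) = G / N ^+ 2 * r); last first.
  by rewrite -oz; case: (o * _) => a b /=; rewrite mul0r subr0.
apply: lerD.
  rewrite (_ : G / (2 * r) = G / (2 * r ^+ 2) * r); last by field; rewrite gt_eqF.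
  rewrite ler_wpM2r ?(ltW r0)// ler_wpM2l// lef_pV2 ?posrE ?exprn_gt0//.
  by rewrite mulr_gt0// exprn_gt0.
have : `|complex.Re (o * ((w - G%:C) / z))| <= e / r.
  apply: le_trans (abs_Re_normc _) _.
  rewrite !Normc.normcM o1 mul1r Normc.normcV -/N ler_pM ?normc_ge0 ?invr_ge0 ?(ltW N0)//.
  by rewrite lef_pV2 ?posrE.
by rewrite ler_norml => /andP[].
Qed.

(* After a rotation making g 0 nonnegative, [circ] of g z / z does not depend on the side of
   the square; the limit at 0 bounds it below by 4 |g 0|, the triangle inequality bounds it
   above. As g need not be differentiable at 0, this applies to (F z - F 0) / z. *)
Lemma square_mean g (s : R) : 0 < s ->
  (forall z, in_square s z -> z != 0 -> differentiable g z) ->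
  {for 0, continuous g} ->
  4 * s * normc (g 0) <= segint (sides (normc \o g) s) (- s) s.
Proof.
move=> s0 dg cg; set G := normc (g 0).
have [u [u1 ug]] := exists_rotation (g 0).
pose F z := u * g z * z^-1.
have dF z : in_square s z -> z != 0 -> differentiable F z.
  move=> sq z0; rewrite /F.
  apply: (@differentiableM _ _ (fun z => u * g z) (fun z => z^-1)).
    by apply: (@differentiableZ _ _ _ g u); exact: dg.
  exact: (@differentiableV _ _ (fun z => z)).
have sqS r z : r <= s -> in_square r z -> in_square s z.
  by move=> rs [h1 h2]; split; exact: le_trans rs.
set U := fun x y => complex.Re (F (x +i* y)).
set V := fun x y => complex.Im (F (x +i* y)).
(* On a square of half-side r so small that g is within e of g 0, four sides of length 2 r
   contribute at least 4 (2 r) (G / (2 r) - e / r) = 4 G - 8 e. *)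
have GE e : 0 < e -> 4 * G - 8 * e <= circ U V (- s) s (- s) s.
  move=> e0.
  have /near_normP[d d0 dP] : \forall z \near (0 : R[i]), `|g 0 - g z| <= e%:C.
    have : \forall w \near g 0, `|g 0 - w| <= e%:C.
      by apply/near_normP; exists e => // w /ltW; rewrite distrC.
    by move/cg.
  (* Points of this square have modulus at most 2 r, which must stay below d. *)
  pose r := Num.min s (d / 3).
  have r0 : 0 < r by rewrite lt_min s0 divr_gt0.
  have rs : r <= s by rewrite ge_min lexx.
  have rd : 2 * r < d.
    have : r <= d / 3 by rewrite ge_min lexx orbT.
    by lra.
  rewrite (@circ_annulus R U V r s r0 rs); last first.
    move=> p q ps qs pq; apply: holomorphic_cauchy_riemann; apply: dF => //.
    apply: contraTN isT => /eqP[p0 q0]; move: pq; rewrite p0 q0 normr0.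
    by case=> /(lt_le_trans r0); rewrite ltxx.
  have [cf ->] := @circ_sides F r r0 (fun z sq => dF z (sqS _ _ rs sq)).
  set f := (X in segint X).
  have low o z : normc o = 1 -> complex.Re (o * z^*%C) = r ->
      `|complex.Re z| <= r -> `|complex.Im z| <= r -> r <= normc z ->
      G / (2 * r) - e / r <= complex.Re (o * F z).
    move=> o1 oz zr zi rz; apply: side_lower => //.
    - have -> : normc z ^+ 2 = complex.Re z ^+ 2 + complex.Im z ^+ 2.
        by apply/(@complexI R); rewrite add_Re2_Im2 normr_normc rmorphXn.
      rewrite mulr_natl mulr2n lerD// -[leLHS]real_normK ?num_real//;
        by rewrite lerXn2r ?nnegrE// ltW.
    - exact: normc_ge0.
    - rewrite -ug -mulrBr Normc.normcM u1 mul1r -lecR -normr_normc distrC.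
      apply: dP; rewrite subr0 normr_normc ltcR; apply: le_lt_trans rd.
      by case: z zr zi {oz rz} => a b /= zr zi; apply: le_trans (normc_le_ReIm _ _) _; lra.
  have : (4 * (G / (2 * r) - e / r)) * (r - - r) <= segint f (- r) r.
    apply: segint_ge_cst => //; first lra.
    move=> t; rewrite -ler_norml => tr.
    have rE : `|r| = r by rewrite gtr0_norm.
    (* The factors 1, -1, i, -i are the outward normals of the right, left, upper and lower
       sides. *)
    have h1 : G / (2 * r) - e / r <= complex.Re ((1 +i* 0) * F (r +i* t)).
      apply: low.
      - by rewrite /= ?oppr0 ?sqrrN expr0n expr1n ?addr0 ?add0r sqrtr1.
      - by rewrite /=; ring.
      - by rewrite /= ?normrN ?rE.
      - by rewrite /= ?normrN ?rE.
      - by rewrite -{1}rE ; exact: (abs_Re_normc (r +i* t)).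
    have h2 : G / (2 * r) - e / r <= complex.Re (((-1) +i* 0) * F ((- r) +i* t)).
      apply: low.
      - by rewrite /= ?oppr0 ?sqrrN expr0n expr1n ?addr0 ?add0r sqrtr1.
      - by rewrite /=; ring.
      - by rewrite /= ?normrN ?rE.
      - by rewrite /= ?normrN ?rE.
      - by rewrite -{1}rE -normrN; exact: (abs_Re_normc ((- r) +i* t)).
    have h3 : G / (2 * r) - e / r <= complex.Re ((0 +i* 1) * F (t +i* r)).
      apply: low.
      - by rewrite /= ?oppr0 ?sqrrN expr0n expr1n ?addr0 ?add0r sqrtr1.
      - by rewrite /=; ring.
      - by rewrite /= ?normrN ?rE.
      - by rewrite /= ?normrN ?rE.
      - by rewrite -{1}rE ; exact: (abs_Im_normc (t +i* r)).
    have h4 : G / (2 * r) - e / r <= complex.Re ((0 +i* (-1)) * F (t +i* (- r))).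
      apply: low.
      - by rewrite /= ?oppr0 ?sqrrN expr0n expr1n ?addr0 ?add0r sqrtr1.
      - by rewrite /=; ring.
      - by rewrite /= ?normrN ?rE.
      - by rewrite /= ?normrN ?rE.
      - by rewrite -{1}rE -normrN; exact: (abs_Im_normc (t +i* (- r))).
    rewrite /f; move: h1 h2 h3 h4.
    case: (F (r +i* t)) => a1 b1; case: (F ((- r) +i* t)) => a2 b2.
    case: (F (t +i* r)) => a3 b3; case: (F (t +i* (- r))) => a4 b4 /=.
    by move=> h1 h2 h3 h4; lra.
  apply: le_trans; rewrite le_eqVlt; apply/orP; left; apply/eqP.
  by field; rewrite gt_eqF.
have cn z : in_square s z -> z != 0 -> {for z, continuous (normc \o g)}.
  move=> sq z0; apply: continuous_comp; last exact: normc_continuous.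
  by apply: differentiable_continuous; exact: dg.
have [c1 c2 c3 c4] := cts_on_sides s0 cn.
have csides : cts_on (sides (normc \o g) s) (- s) s.
  exact: (cts_onD (cts_onD (cts_onD c1 c2) c3) c4).
have up : circ U V (- s) s (- s) s <= s^-1 * segint (sides (normc \o g) s) (- s) s.
  have [cf ->] := circ_sides s0 dF.
  rewrite -segintZ//; apply: le_segint => //.
    by move=> t ts; apply: cvgM; [exact: cvg_cst|exact: csides].
  move=> t; rewrite -ler_norml => ts.
  have sE : `|s| = s by rewrite gtr0_norm.
  have B z : s <= normc z -> normc (F z) <= s^-1 * normc (g z).
    move=> sz; rewrite /F !Normc.normcM u1 mul1r Normc.normcV mulrC.
    rewrite ler_wpM2r ?normc_ge0// lef_pV2 ?posrE//.
    exact: lt_le_trans sz.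
  have b1 : normc (F (s +i* t)) <= s^-1 * normc (g (s +i* t)).
    by apply: B; rewrite -{1}sE; exact: (abs_Re_normc (s +i* t)).
  have b2 : normc (F ((- s) +i* t)) <= s^-1 * normc (g ((- s) +i* t)).
    by apply: B; rewrite -{1}sE -normrN; exact: (abs_Re_normc ((- s) +i* t)).
  have b3 : normc (F (t +i* s)) <= s^-1 * normc (g (t +i* s)).
    by apply: B; rewrite -{1}sE; exact: (abs_Im_normc (t +i* s)).
  have b4 : normc (F (t +i* (- s))) <= s^-1 * normc (g (t +i* (- s))).
    by apply: B; rewrite -{1}sE -normrN; exact: (abs_Im_normc (t +i* (- s))).
  have := abs_Re_normc (F (s +i* t)); rewrite ler_norml => /andP[_ f1].
  have := abs_Re_normc (F ((- s) +i* t)); rewrite ler_norml => /andP[f2 _].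
  have := abs_Im_normc (F (t +i* s)); rewrite ler_norml => /andP[f3 _].
  have := abs_Im_normc (F (t +i* (- s))); rewrite ler_norml => /andP[_ f4].
  rewrite /sides /= !mulrDr.
  by lra.
have : 4 * G <= s^-1 * segint (sides (normc \o g) s) (- s) s.
  apply/ler_addgt0Pr => e e0.
  have := le_trans (GE (e / 8) (divr_gt0 e0 (ltr0n _ 8))) up.
  by lra.
by rewrite ler_pdivlMl// mulrA (mulrC s).
Qed.

End square_mean.

(** * Real-valued norms on complex spaces *)

Section real_norm.
Context (R : realType) (V : normedModType R[i]).
Implicit Types v w : V.

(* The norm of a complex space takes its values in R[i]. *)
Definition nrm v : R := complex.Re `|v|.

Lemma nrmE v : `|v| = (nrm v)%:C.
Proof. by rewrite RRe_real// ger0_real. Qed.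

Lemma nrm_ge0 v : 0 <= nrm v.
Proof. by rewrite -ler0c -nrmE. Qed.

Lemma nrm_eq0 v : (nrm v == 0) = (v == 0).
Proof. by rewrite -(inj_eq (@complexI R)) -nrmE normr_eq0. Qed.

Lemma nrmD v w : nrm (v + w) <= nrm v + nrm w.
Proof. by rewrite -lecR rmorphD/= -!nrmE ler_normD. Qed.

Lemma nrmZ (k : R[i]) v : nrm (k *: v) = Normc.normc k * nrm v.
Proof. by apply/(@complexI R); rewrite rmorphM/= -normr_normc -!nrmE normrZ. Qed.

Lemma nrmBC v w : nrm (v - w) = nrm (w - v).
Proof. by rewrite /nrm distrC. Qed.

End real_norm.

(** * Cauchy estimates and Lipschitz bounds *)

Section derivative_bound.
Context (R : realType).
Local Notation normc := (@Normc.normc R).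

Lemma nrm_normc (z : R[i]) : nrm z = normc z.
Proof. by apply/(@complexI R); rewrite -nrmE normr_normc. Qed.

Lemma near_eq_differentiable (V W : normedModType R[i]) (f g : V -> W) (z : V) :
  (\forall y \near z, f y = g y) -> differentiable f z -> differentiable g z.
Proof.
move=> fg df; apply: (eps_differentiable (L := 'd f z)); first exact: diff_continuous.
move=> e e0; have [d d0 dP] := differentiable_eps df e0.
have /near_normP[r r0 rP] := fg.
exists (Num.min d r); first by rewrite lt_min d0.
move=> h hd; rewrite -(rP z) ?subrr ?normr0 ?ltcR// -(rP (z + h)).
  by apply: dP; apply: lt_le_trans hd _; rewrite lecR ge_min lexx.
by rewrite addrC addKr; apply: lt_le_trans hd _; rewrite lecR ge_min lexx orbT.
Qed.

Lemma sides_le (h : R[i] -> R) (s M : R) : 0 < s ->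
  (forall z, in_square s z -> z != 0 -> {for z, continuous h}) ->
  (forall z, in_square s z -> s <= normc z -> h z <= M) ->
  segint (sides h s) (- s) s <= 8 * s * M.
Proof.
move=> s0 ch hM; have [c1 c2 c3 c4] := cts_on_sides s0 ch.
have sE : `|s| = s by rewrite gtr0_norm.
rewrite (_ : 8 * s * M = 4 * M * (s - - s)); last by ring.
apply: segint_le_cst; first by lra.
  exact: (cts_onD (cts_onD (cts_onD c1 c2) c3) c4).
move=> t; rewrite -ler_norml => ts; rewrite /sides.
rewrite (_ : 4 * M = M + M + M + M); last by ring.
rewrite !lerD//; apply: hM.
- by split; rewrite /= ?sE.
- by rewrite -{1}sE; exact: (abs_Re_normc (s +i* t)).
- by split; rewrite /= ?normrN ?sE.
- by rewrite -{1}sE -normrN; exact: (abs_Re_normc ((- s) +i* t)).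
- by split; rewrite /= ?sE.
- by rewrite -{1}sE; exact: (abs_Im_normc (t +i* s)).
- by split; rewrite /= ?normrN ?sE.
- by rewrite -{1}sE -normrN; exact: (abs_Im_normc (t +i* (- s))).
Qed.

(** [square_mean] is applied to the difference quotient [q], given the value D at 0, where
    differentiability of F is exactly continuity of [q]. On the boundary |q| <= 2 M / s and the
    perimeter is 8 s, so 4 s |D| <= 16 M. *)
Lemma derivative_le (F : R[i] -> R[i]) (s M : R) : 0 < s ->
  (forall z, in_square s z -> differentiable F z) ->
  (forall z, in_square s z -> normc (F z) <= M) ->
  normc ('d F 0 1) <= 4 * M / s.
Proof.
move=> s0 dF FM.
have sq0 : in_square s 0 by split; rewrite /= normr0 ltW.
pose D : R[i] := 'd F 0 1.
have DE (h : R[i]) : 'd F 0 h = h * D.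
  by rewrite -[in LHS](mulr1 h) -[h * 1]/(h *: (1 : R[i]^o)) linearZ.
pose q (z : R[i]) : R[i] := if z == 0 then D else (F z - F 0) * z^-1.
have q0 : q 0 = D by rewrite /q eqxx.
have qV (a y : R[i]) : y != 0 -> a / y - D = (a - y * D) / y by move=> y0; field.
have qE z : z != 0 -> q z = (F z - F 0) * z^-1 by move=> /negbTE z0; rewrite /q z0.
have dq z : in_square s z -> z != 0 -> differentiable q z.
  move=> sq z0; apply: (@near_eq_differentiable _ _ (fun z => (F z - F 0) * z^-1)).
    apply/near_normP; exists (normc z).
      by rewrite -ltcR -normr_normc normr_gt0.
    move=> y yz; rewrite qE//; apply: contraTN yz => /eqP ->.
    by rewrite sub0r normrN normr_normc ltxx.
  apply: (@differentiableM _ _ (fun z => F z - F 0) (fun z => z^-1)).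
    by apply: (@differentiableB _ _ _ F (cst (F 0))) => //; exact: dF.
  exact: (@differentiableV _ _ (fun z => z)).
have cq : {for 0, continuous q}.
  apply/(@cvgrPdist_le R[i] R[i] _ _ (nbhs_filter (0 : R[i]))) => e e0.
  have er : (complex.Re e)%:C = e by rewrite RRe_real// gtr0_real.
  have {}e0 : 0 < complex.Re e by rewrite -ltcR er.
  have [d d0 dP] := differentiable_eps (dF 0 sq0) e0.
  apply/near_normP; exists d => // y; rewrite subr0 => yd.
  have [->|y0] := eqVneq y 0; first by rewrite subrr normr0 -er lecR ltW.
  rewrite q0 qE// -er distrC.
  rewrite (qV _ _ y0).
  rewrite normrM normfV ler_pdivrMr ?normr_gt0//.
  by have := dP y yd; rewrite add0r DE.
have := square_mean s0 dq cq; rewrite q0 => h1.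
have M0 : 0 <= M by apply: le_trans (FM _ sq0); exact: normc_ge0.
have : segint (sides (normc \o q) s) (- s) s <= 8 * s * (2 * M / s).
  apply: sides_le => //.
    move=> z sq z0; apply: continuous_comp; last exact: normc_continuous.
    by apply: differentiable_continuous; exact: dq.
  move=> z sq sz /=; rewrite qE; last first.
    by apply: contraTN sz => /eqP ->; rewrite Normc.normc0 -ltNge.
  rewrite Normc.normcM Normc.normcV; apply: ler_pM; rewrite ?invr_ge0 ?normc_ge0//.
    rewrite mulr_natl mulr2n; apply: le_trans (le_normcD _ _) _.
    by rewrite normcN lerD// FM.
  by rewrite lef_pV2 ?posrE//; exact: lt_le_trans sz.
move=> /(le_trans h1).
rewrite (_ : 8 * s * (2 * M / s) = 4 * s * (4 * M / s)); last by field; rewrite gt_eqF.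
by rewrite ler_pM2l// mulr_gt0.
Qed.

Lemma diff_line (V W : normedModType R[i]) (f : V -> W) (z h : V) (t : R[i]) :
  differentiable f (z + t *: h) ->
  differentiable (fun s : R[i] => f (z + s *: h)) t /\
  'd (fun s : R[i] => f (z + s *: h)) t 1 = 'd f (z + t *: h) h.
Proof.
move=> df.
pose l (s : R[i]) : V := z + s *: h.
have did : differentiable (fun s : R[i] => s) t by exact: ex_diff.
have dl1 : differentiable (fun s : R[i] => s *: h) t by exact: differentiableZl.
have dl : differentiable l t by exact: (differentiableD (differentiable_cst z t) dl1).
(* The increment of [l] is exactly linear, so testing the approximation at the single increment d /
   2 already bounds the distance between the two sides by e. *)
have dlE : 'd l t 1 = h.
  apply/eqP; rewrite -subr_eq0 -nrm_eq0 eq_le nrm_ge0 andbT.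
  apply/ler_addgt0Pr => e e0; rewrite add0r.
  have [d d0 dP] := differentiable_eps dl e0.
  have d20 : 0 < d / 2 by rewrite divr_gt0.
  have := dP (d / 2)%:C; rewrite normr_normc normc_real gtr0_norm// ltcR.
  rewrite ltr_pdivrMr// ltr_pMr// ltr1n => /(_ isT).
  have -> : l (t + (d / 2)%:C) - l t - 'd l t (d / 2)%:C = (d / 2)%:C *: (h - 'd l t 1).
    rewrite -[X in 'd l t X]mulr1 -[X in 'd l t X]/((d / 2)%:C *: (1 : R[i])) linearZ/=.
    have -> (s : R[i]) : l (t + s) - l t = s *: h.
      by apply/eqP; rewrite subr_eq /l addrCA -scalerDl (addrC s).
    by rewrite scalerBr.
  rewrite nrmE -rmorphM lecR nrmZ normc_real gtr0_norm// mulrC ler_pM2r//.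
  by rewrite nrmBC.
split; first exact: (differentiable_comp dl).
by rewrite (diff_comp dl df) -[LHS]/('d f (l t) ('d l t 1)) dlE.
Qed.

Lemma holomorphic_derivative_le (V : normedModType R[i]) (f : V -> R[i]) (z h : V) (r M : R) :
  0 < r -> (forall w, nrm (w - z) < r -> differentiable f w) ->
  (forall w, nrm (w - z) < r -> normc (f w) <= M) ->
  normc ('d f z h) <= 12 * M / r * nrm h.
Proof.
move=> r0 df fM.
have M0 : 0 <= M by apply: le_trans (fM z _); rewrite ?normc_ge0// /nrm subrr normr0.
have [->|h0] := eqVneq h 0.
  by rewrite linear0 Normc.normc0 mulr_ge0 ?nrm_ge0// divr_ge0 ?mulr_ge0// ltW.
have nh : 0 < nrm h by rewrite lt_neqAle eq_sym nrm_eq0 h0 nrm_ge0.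
(* This scales h to norm r / 3: points of the unit square have modulus at most 2, so the line stays
   within 2 r / 3 of z. The bound 4 M in the direction k h becomes 12 M |h| / r in the direction
   h. *)
pose k : R := r / (3 * nrm h).
have k0 : 0 < k by rewrite divr_gt0// mulr_gt0.
pose h' := k%:C *: h.
have nh' : nrm h' = r / 3.
  by rewrite nrmZ normc_real gtr0_norm// /k; field; rewrite gt_eqF.
have sq (t : R[i]) : in_square 1 t -> nrm (z + t *: h' - z) < r.
  move=> [tr ti]; rewrite addrAC subrr add0r nrmZ nh'.
  have : normc t <= 2.
    by case: t tr ti => a b /= ? ?; apply: le_trans (normc_le_ReIm _ _) _; lra.
  move=> t2; have : normc t * (r / 3) <= 2 * (r / 3) by rewrite ler_wpM2r// divr_ge0// ltW.
  by move/le_lt_trans; apply; lra.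
have dF t : in_square 1 t -> differentiable (fun s : R[i] => f (z + s *: h')) t.
  by move=> /sq/df dft; have [] := diff_line dft.
have := derivative_le ltr01 dF (fun t st => fM _ (sq t st)).
have sq0 : in_square 1 (0 : R[i]) by split; rewrite /= normr0.
have [_ ->] := @diff_line _ _ f z h' 0 (df _ (sq 0 sq0)).
rewrite scale0r addr0 divr1 linearZ/= -[_ *: _]/(k%:C * _) Normc.normcM.
rewrite normc_real gtr0_norm// mulrC -ler_pdivlMr// => /le_trans; apply.
rewrite le_eqVlt; apply/orP; left; apply/eqP.
by rewrite /k; field; rewrite !gt_eqF.
Qed.

(** The mean value theorem fails for complex-valued functions. It is applied to Re (u f) along the
    segment, where the rotation u makes f (z + h) - f z a nonnegative real, so that taking real
    parts loses nothing. *)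
Lemma derivative_lipschitz (V : normedModType R[i]) (f : V -> R[i]) (z h : V) (C : R) :
  (forall s : R, 0 <= s <= 1 -> differentiable f (z + s%:C *: h)) ->
  (forall s : R, 0 <= s <= 1 -> normc ('d f (z + s%:C *: h) h) <= C) ->
  normc (f (z + h) - f z) <= C.
Proof.
move=> df dC; set D := f (z + h) - f z.
have [u [u1 uD]] := exists_rotation D.
pose p (s : R) := complex.Re (u * f (z + s%:C *: h)).
pose dp (s : R) := complex.Re (u * 'd f (z + s%:C *: h) h).
have dpP (s : R) : 0 <= s <= 1 -> is_derive s 1 p (dp s).
  move=> s01; set w := z + s%:C *: h.
  have H : (fun t : R => t^-1 *: ((p \o shift s) (t *: (1 : R)) - p s)) @ 0^' --> dp s.
    apply/cvgrPdist_le => e e0.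
    have e0' : 0 < e / (nrm h + 1) by rewrite divr_gt0// ltr_wpDl// nrm_ge0.
    have [d d0 dP] := differentiable_eps (df s s01) e0'.
    have d0' : 0 < d / (nrm h + 1) by rewrite divr_gt0// ltr_wpDl// nrm_ge0.
    rewrite near_withinE; apply/nbhs_ballP; exists (d / (nrm h + 1)) => //= t.
    rewrite /ball/= sub0r normrN => td t0.
    have nth : nrm (t%:C *: h) <= `|t| * (nrm h + 1).
      by rewrite nrmZ normc_real ler_wpM2l// lerDl.
    have := dP (t%:C *: h); rewrite !nrmE ltcR -rmorphM lecR => /(_ _)/wrap[].
      by apply: le_lt_trans nth _; rewrite -ltr_pdivlMr// ltr_wpDl// nrm_ge0.
    rewrite linearZ/= nrm_normc -/w -[_ *: 'd f w h]/(t%:C * 'd f w h) => {}dP.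
    have := le_trans dP (ler_wpM2l (ltW e0') nth).
    have -> : e / (nrm h + 1) * (`|t| * (nrm h + 1)) = e * `|t|.
      by field; rewrite gt_eqF// ltr_wpDl// nrm_ge0.
    set X := (X in normc X <= _) => HX.
    have -> : dp s - t^-1 *: ((p \o shift s) (t *: 1) - p s) = - t^-1 * complex.Re (u * X).
      rewrite /dp /p /X /= -/w.
      have -> : z + (t *: 1 + s)%:C *: h = w + t%:C *: h.
        by rewrite -[t *: 1]/(t * 1) mulr1 /w -addrA -scalerDl -rmorphD (addrC s).
      rewrite -[t^-1 *: _]/(t^-1 * _).
      case: (f (w + _)) => a b; case: (f w) => a' b'; case: ('d f w h) => x y; case: (u) => c e1 /=.
      by field.
    rewrite normrM normrN normfV mulrC ler_pdivrMr ?normr_gt0//.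
    apply: le_trans (abs_Re_normc _) _.
    by rewrite Normc.normcM u1 mul1r.
  by apply: DeriveDef; [apply/cvg_ex; exists (dp s)|exact/cvg_lim].
have pc : {within `[0, 1], continuous p}.
  apply: continuous_in_subspaceT => x; rewrite inE/= in_itv/= => x01.
  apply: differentiable_continuous; apply/derivable1_diffP.
  by have [] := dpP x x01.
have [] := @MVT R p dp 0 1 ltr01 _ pc.
  by move=> x; rewrite in_itv/= => /andP[x0 x1]; apply: dpP; rewrite !ltW.
move=> c; rewrite in_itv/= => /andP[c0 c1].
rewrite subr0 mulr1 /p scale1r scale0r addr0 => pE.
have -> : normc D = dp c.
  rewrite -pE; have -> : normc D = complex.Re (u * D) by rewrite uD.
  rewrite /D; case: (f (z + h)) => a b; case: (f z) => a' b'; case: (u) => x y /=.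
  by ring.
apply: le_trans (ler_norm _) _; apply: le_trans (abs_Re_normc _) _.
by rewrite Normc.normcM u1 mul1r dC// !ltW.
Qed.

(** Each point of the segment from z to z + h is the centre of a ball of radius r inside the ball of
    radius 2 r about z, so the derivative bound is uniform along the segment. *)
Lemma holomorphic_lipschitz (V : normedModType R[i]) (f : V -> R[i]) (z h : V) (r M : R) :
  (forall w, nrm (w - z) < 2 * r -> differentiable f w) ->
  (forall w, nrm (w - z) < 2 * r -> normc (f w) <= M) -> nrm h < r ->
  normc (f (z + h) - f z) <= 12 * M / r * nrm h.
Proof.
move=> df fM hr; have r0 : 0 < r by apply: le_lt_trans hr; exact: nrm_ge0.
have sh (s : R) : 0 <= s <= 1 -> nrm (s%:C *: h) < r.
  move=> /andP[s0 s1]; apply: le_lt_trans hr.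
  by rewrite nrmZ normc_real ger0_norm// ler_piMl// nrm_ge0.
have near (s : R) w : 0 <= s <= 1 -> nrm (w - (z + s%:C *: h)) < r -> nrm (w - z) < 2 * r.
  move=> s01 wr; rewrite (_ : w - z = w - (z + s%:C *: h) + s%:C *: h).
    by apply: le_lt_trans (nrmD _ _) _; rewrite mulr_natl mulr2n ltrD// sh.
  by rewrite opprD addrA subrK.
apply: derivative_lipschitz => s s01.
  by apply/df/(near s) => //; rewrite /nrm subrr normr0.
apply: holomorphic_derivative_le => // w wr; [apply: df|apply: fM]; exact: near wr.
Qed.

End derivative_bound.

(** * Translation and reflection invariance on the real line *)

Section lebesgue_invariance.
Context (R : realType).
Local Notation mu := (@lebesgue_measure R).

Definition translation (c x : measurableTypeR R) : measurableTypeR R := c + x.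

Lemma measurable_translation c : measurable_fun setT (translation c).
Proof. exact: measurable_funD. Qed.

HB.instance Definition _ c :=
  isMeasurableFun.Build _ _ _ _ (translation c) (measurable_translation c).

Lemma lebesgue_measureD (c : R) (X : set R) : measurable X ->
  pushforward mu (translation c) X = mu X.
Proof.
move=> mX; apply/esym/lebesgue_measure_unique => //= _ [[a b]] _ <-.
rewrite /pushforward (_ : _ @^-1` _ = `]a - c, b - c]%classic); last first.
  by apply/seteqP; split=> x /=; rewrite !in_itv/= ltrBlDl lerBrDl.
rewrite !lebesgue_measure_itv/= !lte_fin ltrD2r.
by rewrite -!EFinD opprB addrA subrK.
Qed.

Lemma ge0_integralD_shift (f : R -> \bar R) (c : R) :
  measurable_fun setT f -> (forall x, 0 <= f x)%E ->
  (\int[mu]_x f (c + x)%R = \int[mu]_x f x)%E.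
Proof.
move=> mf f0.
transitivity (\int[pushforward mu (translation c)]_x f x)%E.
  by rewrite ge0_integral_pushforward.
by apply: eq_measure_integral => // X mX _; exact: lebesgue_measureD.
Qed.

Lemma ge0_integralB_shift (f : R -> \bar R) (c : R) :
  measurable_fun setT f -> (forall x, 0 <= f x)%E ->
  (\int[mu]_x f (c - x)%R = \int[mu]_x f x)%E.
Proof.
move=> mf f0.
rewrite -[RHS](ge0_integralD_shift c)//.
transitivity (\int[pushforward mu (-%R : _ -> measurableTypeR R)]_x f (c + x)%R)%E.
  rewrite ge0_integral_pushforward//.
  by apply: measurableT_comp => //; exact: measurable_funD.
by apply: eq_measure_integral => // X mX _; exact: lebesgue_measureN.
Qed.

End lebesgue_invariance.

(** * From boundary integrals to area integrals *)

Section plane_mean.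
Context (R : realType).
Local Notation T := (measurableTypeR R * measurableTypeR R)%type.
Local Notation mu := (@lebesgue_measure R).
Local Notation normc := (@Normc.normc R).

(** The hypothesis is integrated over r in [s / 2, s], of length s / 2, and its right-hand side,
    being nonnegative, over the whole line. By Tonelli and invariance each of the four terms then
    gives the full integral J, whence b s / 2 <= 4 J. *)
Lemma plane_average (K : T -> \bar R) (c1 c2 s b : R) : 0 < s -> 0 <= b ->
  measurable_fun setT K -> (forall w, 0 <= K w)%E ->
  (forall r : R, s / 2 <= r <= s ->
    (b%:E <= \int[mu]_t K ((c1 + r)%R, t) + \int[mu]_t K ((c1 - r)%R, t) +
             \int[mu]_t K (t, (c2 + r)%R) + \int[mu]_t K (t, (c2 - r)%R))%E) ->
  ((b * s)%:E <= 8%:E * \int[lebesgue2 R]_w K w)%E.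
Proof.
move=> s0 b0 mK K0 h.
pose G x := (\int[mu]_t K (x, t))%E; pose H y := (\int[mu]_t K (t, y))%E.
have mG : measurable_fun setT G by exact: (measurable_fun_fubini_tonelli_F K mK K0).
have mH : measurable_fun setT H by exact: (measurable_fun_fubini_tonelli_G K mK K0).
have G0 x : (0 <= G x)%E by exact: integral_ge0.
have H0 x : (0 <= H x)%E by exact: integral_ge0.
set J := (\int[lebesgue2 R]_w K w)%E.
have JG : J = (\int[mu]_x G x)%E by exact: (@fubini_tonelli1 _ _ _ _ _ mu mu K mK K0).
have JH : J = (\int[mu]_x H x)%E by exact: (@fubini_tonelli2 _ _ _ _ _ mu mu K mK K0).
have mD (f : R -> \bar R) c : measurable_fun setT f ->
    measurable_fun setT (fun r : R => f (c + r)%R).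
  by move=> mf; apply: measurableT_comp => //; exact: measurable_funD.
have mB (f : R -> \bar R) c : measurable_fun setT f ->
    measurable_fun setT (fun r : R => f (c - r)%R).
  by move=> mf; apply: measurableT_comp => //; exact: measurable_funB.
have p2 x : (0 <= G (c1 + x)%R + G (c1 - x)%R)%E by exact: adde_ge0.
have p3 x : (0 <= G (c1 + x)%R + G (c1 - x)%R + H (c2 + x)%R)%E by exact: adde_ge0.
have p4 x : (0 <= G (c1 + x)%R + G (c1 - x)%R + H (c2 + x)%R + H (c2 - x)%R)%E by exact: adde_ge0.
have I4 : (\int[mu]_r (G (c1 + r)%R + G (c1 - r)%R + H (c2 + r)%R + H (c2 - r)%R) = 4%:E * J)%E.
  have m1 := mD _ c1 mG; have m2 := mB _ c1 mG; have m3 := mD _ c2 mH; have m4 := mB _ c2 mH.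
  have m12 := emeasurable_funD m1 m2; have m123 := emeasurable_funD m12 m3.
  rewrite ge0_integralD//.
  rewrite ge0_integralD//.
  rewrite ge0_integralD//.
  rewrite !ge0_integralD_shift// !ge0_integralB_shift// -JG -JH.
  by rewrite -[in RHS](_ : 1 + 1 + 1 + 1 = 4 :> R)%R ?EFinD;
    [rewrite !ge0_muleDl ?mul1e//; rewrite ?adde_ge0|ring].
have : (\int[mu]_(r in `[(s / 2)%R, s]) b%:E <= 4%:E * J)%E.
  rewrite -I4 integral_mkcond.
  apply: ge0_le_integral => //.
  - by move=> x _; rewrite patchE; case: ifP.
  - apply/(measurable_restrictT _ _).1 => //.
  - apply: emeasurable_funD; [apply: emeasurable_funD; [apply: emeasurable_funD|]|].
    + exact: mD.
    + exact: mB.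
    + exact: mD.
    + exact: mB.
  - move=> x _; rewrite patchE; case: ifP => xs; last exact: p4.
    by apply: h; move: xs; rewrite inE/= in_itv.
rewrite integral_cst// [X in (_ * X)%E](_ : _ = (s / 2)%:E); last first.
  rewrite [LHS](lebesgue_measure_itv `[(s / 2)%R, s])/= lte_fin ltr_pdivrMr// ltr_pMr// ltr1n/=.
  by rewrite -EFinD {1}(splitr s) addrK.
rewrite -EFinM => h4.
have : (2%:E * (b * (s / 2))%:E <= 2%:E * (4%:E * J))%E by rewrite lee_pmul2l.
rewrite -EFinM muleA -EFinM (_ : 2 * (b * (s / 2)) = b * s)%R; last by field.
by rewrite (_ : 2 * 4 = 8 :> R)%R//; ring.
Qed.

Lemma EFin_segint (f : R -> R) a b : cts_on f a b ->
  (segint f a b)%:E = (\int[mu]_(x in `[a, b]) (f x)%:E)%E.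
Proof.
move=> cf; rewrite /segint /Rintegral fineK//.
by apply: integrable_fin_num => //; exact: cts_on_integrable.
Qed.

(* [square_mean] for F ^ 2, integrated over the squares of half-side r in [s / 2, s]. *)
Lemma plane_mean (K : T -> \bar R) (F : R[i] -> R[i]) (c : T) (s : R) : 0 < s ->
  measurable_fun setT K -> (forall w, 0 <= K w)%E ->
  (forall z, in_square s z -> differentiable F z) ->
  (forall x y : R, `|x| <= s -> `|y| <= s ->
    K ((c.1 + x)%R, (c.2 + y)%R) = ((normc (F (x +i* y))) ^+ 2)%:E) ->
  ((s ^+ 2 * normc (F 0) ^+ 2)%:E <= 4%:E * \int[lebesgue2 R]_w K w)%E.
Proof.
move=> s0 mK K0 dF KF; set a := normc (F 0) ^+ 2.
have a0 : 0 <= a by rewrite sqr_ge0.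
(* The [b] of [plane_average] is 2 s a, because [square_mean] gives 4 r a and r >= s / 2. *)
suff : ((2 * s * a * s)%:E <= 8%:E * \int[lebesgue2 R]_w K w)%E.
  rewrite (_ : 8 = 2 * 4 :> R)%R; last by ring.
  rewrite (_ : 2 * s * a * s = 2 * (s ^+ 2 * a))%R; last by ring.
  by rewrite (EFinM 2 (s ^+ 2 * a)) (EFinM 2 4) -muleA lee_pmul2l.
apply: (@plane_average K c.1 c.2) => //.
  by apply: mulr_ge0 => //; rewrite mulr_ge0// ltW.
move=> r /andP[sr rs].
have r0 : 0 < r by apply: lt_le_trans sr; rewrite divr_gt0.
have dF2 z : in_square r z -> differentiable (fun z => F z ^+ 2) z.
  move=> [zr zi]; rewrite (_ : (fun z => _) = F * F); last by apply/funext => ?; rewrite expr2.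
  by apply: differentiableM; apply: dF; split; apply: le_trans rs.
have cn z : in_square r z -> {for z, continuous (normc \o (fun z => F z ^+ 2))}.
  move=> sq; apply: continuous_comp; last exact: normc_continuous.
  by apply: differentiable_continuous; exact: dF2.
have in0 : in_square r 0 by split; rewrite /= normr0 ltW.
have := @square_mean R (fun z => F z ^+ 2) r r0 (fun z sq _ => dF2 z sq)
  (differentiable_continuous (dF2 0 in0)).
have nsq z : normc (F z ^+ 2) = normc (F z) ^+ 2 by rewrite !expr2 Normc.normcM.
rewrite nsq -/a.
have [c1 c2 c3 c4] := @cts_on_sides R _ r r0 (fun z sq _ => cn z sq).
rewrite /sides -segintD//; last exact: (cts_onD (cts_onD c1 c2) c3).
rewrite -segintD//; last exact: (cts_onD c1 c2).
rewrite -segintD// -lee_fin => h.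
apply: (@le_trans _ _ (4 * r * a)%:E).
  by rewrite lee_fin ler_wpM2r//; lra.
apply: le_trans h _; rewrite !EFinD !EFin_segint//.
have mK1 (x : R) : measurable_fun setT (fun t : R => K (x, t)).
  by apply: measurableT_comp => //; exact: measurable_pair1.
have mK2 (y : R) : measurable_fun setT (fun t : R => K (t, y)).
  by apply: measurableT_comp => //; exact: measurable_pair2.
(* A side is part of a full line and K >= 0, so the line integrals in [plane_average] dominate the
   integrals over the sides. *)
have le (k : R -> \bar R) (f : R -> R) (e : R) : measurable_fun setT k -> (forall t, 0 <= k t)%E ->
    (forall t, `|t| <= r -> k (e + t) = (f t)%:E) ->
    (\int[mu]_(t in `[(- r)%R, r]) (f t)%:E <= \int[mu]_t k t)%E.
  move=> mk k0 kf; rewrite -(ge0_integralD_shift e)//.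
  have -> : (\int[mu]_(t in `[(- r)%R, r]) (f t)%:E = \int[mu]_(t in `[(- r)%R, r]) k (e + t)%R)%E.
    by apply: eq_integral => t; rewrite inE/= in_itv/= -ler_norml => /kf.
  apply: ge0_subset_integral => //.
  by apply: measurableT_comp => //; exact: measurable_funD.
have rE : `|r| = r by rewrite gtr0_norm.
have tr t : `|t| <= r -> `|t| <= s by move=> h; exact: le_trans rs.
apply: leeD; [apply: leeD; [apply: leeD|]|].
- by apply: (le _ _ c.2) => // t /tr ts; rewrite KF ?rE//= nsq.
- by apply: (le _ _ c.2) => // t /tr ts; rewrite KF ?normrN ?rE//= nsq.
- by apply: (le _ _ c.1) => // t /tr ts; rewrite KF ?rE//= nsq.
- by apply: (le _ _ c.1) => // t /tr ts; rewrite KF ?normrN ?rE//= nsq.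
Qed.

End plane_mean.

(** * Iterating a mean inequality over the coordinates *)

Section tuple_mean.
Context d (T : measurableType d) (R : realType).
Context (m : {sigma_finite_measure set T -> \bar R}).

Lemma ge0_integral_tuple_measureS n (P : n.+1.-tuple T -> \bar R) :
  measurable_fun setT P -> (forall t, 0 <= P t)%E ->
  measurable_fun setT (fun w => \int[tuple_measure m n]_t P (consT (w, t)))%E /\
  (\int[tuple_measure m n.+1]_t P t =
   \int[m]_w \int[tuple_measure m n]_t P (consT (w, t)))%E.
Proof.
move=> mP P0.
have mPc : measurable_fun setT (P \o @consT T n).
  by apply: measurableT_comp => //; exact: measurable_consT.
have Pc0 x : (0 <= (P \o @consT T n) x)%E by exact: P0.
split; first exact: (measurable_fun_fubini_tonelli_F (P \o @consT T n) mPc Pc0).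
rewrite -[RHS](@fubini_tonelli1 _ _ _ _ _ m (tuple_measure m n) (P \o @consT T n) mPc Pc0).
exact: (@ge0_integral_pushforward _ _ _ _ _ (@consT T n) (@measurable_consT _ _ n)
  (prodm m (tuple_measure m n)) setT P measurableT mP (fun y _ => P0 y)).
Qed.

Definition upd_tuple n (t : n.-tuple T) (i : 'I_n) (w : T) : n.-tuple T :=
  [tuple if j == i then w else tnth t j | j < n].

Lemma upd_tuple0 n (x : T) (t : n.-tuple T) w :
  upd_tuple (consT (x, t)) ord0 w = consT (w, t).
Proof.
apply: eq_from_tnth => j; rewrite tnth_mktuple.
case: (unliftP ord0 j) => [k|] ->; last by rewrite eqxx tnth0.
by rewrite eq_sym (negbTE (neq_lift _ _)) !tnthS.
Qed.

Lemma upd_tuple_lift n (x : T) (t : n.-tuple T) i w :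
  upd_tuple (consT (x, t)) (lift ord0 i) w = consT (x, upd_tuple t i w).
Proof.
apply: eq_from_tnth => j; rewrite tnth_mktuple.
case: (unliftP ord0 j) => [k|] ->; last first.
  by rewrite (negbTE (neq_lift _ _)) !tnth0.
by rewrite (inj_eq lift_inj) !tnthS tnth_mktuple.
Qed.

Lemma measurable_upd_tuple n (t : n.-tuple T) i : measurable_fun setT (upd_tuple t i).
Proof.
apply/measurable_fun_tnthP => j /=.
have [->|ji] := eqVneq j i.
  rewrite (_ : _ \o _ = id); first exact: measurable_id.
  by apply/funext => w /=; rewrite tnth_mktuple eqxx.
rewrite (_ : _ \o _ = cst (tnth t j)); first exact: measurable_cst.
by apply/funext => w /=; rewrite tnth_mktuple (negbTE ji).
Qed.

(** Induction on [n]. The inequality in the first coordinate bounds [P a] by an integral over w in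
    [Q ord0] with the tail still at its value in [a]; for each such w the induction hypothesis
    bounds the integrand by an integral over tails. As the inequality is assumed at all tuples in
    the product of the [Q i], fixing such a w hands it on to the tail. *)
Lemma tuple_mean (c : R) n (P : n.-tuple T -> \bar R) (a : n.-tuple T) (Q : 'I_n -> set T) :
  0 <= c -> measurable_fun setT P -> (forall t, 0 <= P t)%E ->
  (forall i, measurable (Q i)) ->
  (forall i, Q i (tnth a i)) ->
  (forall i t, (forall j, Q j (tnth t j)) ->
    (P (upd_tuple t i (tnth a i)) <= c%:E * \int[m]_(w in Q i) P (upd_tuple t i w))%E) ->
  (P a <= (c ^+ n)%:E * \int[tuple_measure m n]_t P t)%E.
Proof.
move=> c0; elim: n P a Q => [|n IH] P a Q mP P0 mQ Qa h.
  by rewrite expr0 mul1e integral_dirac// diracE in_setT mul1e (tuple0 a).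
have [mI ->] := ge0_integral_tuple_measureS mP P0.
have aE : a = consT (thead a, [tuple of behead a]) by exact: tuple_eta.
set b := [tuple of behead a].
have bE i : tnth b i = tnth a (lift ord0 i) by rewrite [in RHS]aE tnthS.
have a0 : tnth a ord0 = thead a by [].
have step w : Q ord0 w -> (P (consT (w, b)) <=
    (c ^+ n)%:E * \int[tuple_measure m n]_t P (consT (w, t)))%E.
  move=> Qw; apply: (IH (fun t => P (consT (w, t))) b (fun i => Q (lift ord0 i))).
  - apply: measurableT_comp => //; apply: measurableT_comp; first exact: measurable_consT.
    exact: measurable_pair1.
  - by move=> t; exact: P0.
  - by move=> i; exact: mQ.
  - by move=> i; rewrite bE.
  - move=> i t Qt; have := h (lift ord0 i) (consT (w, t)).
    rewrite upd_tuple_lift bE; under [in X in _ -> X]eq_integral do rewrite -upd_tuple_lift.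
    apply => j; case: (unliftP ord0 j) => [k|] ->; last by rewrite tnth0.
    by rewrite tnthS.
have uE w : upd_tuple a ord0 w = consT (w, b) by rewrite [X in upd_tuple X]aE upd_tuple0.
have : (P a <= c%:E * \int[m]_(w in Q ord0) P (consT (w, b)))%E.
  have := h ord0 a Qa; rewrite uE a0 -aE.
  by under eq_integral do rewrite uE.
move=> /le_trans; apply.
rewrite exprS EFinM -muleA lee_wpmul2l ?lee_fin//.
rewrite -ge0_integralZl//; [|by move=> x _; exact: integral_ge0|by rewrite lee_fin exprn_ge0].
apply: (@le_trans _ _ (\int[m]_(w in Q ord0)
    ((c ^+ n)%:E * \int[tuple_measure m n]_t P (consT (w, t)))))%E.
  apply: ge0_le_integral => //.
  - apply: measurable_funTS.
    apply: measurableT_comp => //; apply: measurableT_comp; first exact: measurable_consT.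
    exact: measurable_pair2.
  - by apply: measurable_funTS; exact: measurable_funeM.
apply: ge0_subset_integral => //; first exact: measurable_funeM.
by move=> w _; rewrite mule_ge0 ?lee_fin ?exprn_ge0//; exact: integral_ge0.
Qed.

End tuple_mean.

(** * Pointwise bounds for Bergman functions *)

Section bergman_sup.
Context (R : realType) (n : nat).
Local Notation T := (measurableTypeR R * measurableTypeR R)%type.
Local Notation normc := (@Normc.normc R).
Implicit Types (v w z : 'rV[R[i]]_n) (Omega : set 'rV[R[i]]_n).

(** The norm of a row is the largest modulus of its entries, so balls are polydiscs. *)
Lemma nrm_row_lt v (r : R) : 0 < r -> (forall i, normc (v ord0 i) < r) -> nrm v < r.
Proof.
move=> r0 vr; rewrite -ltcR -nrmE.
have : ball (0 : 'rV[R[i]]_n) r%:C v.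
  split; first by rewrite ltcR.
  by move=> i j; rewrite ord1 mxE /ball/= sub0r normrN normr_normc ltcR.
by rewrite mx_norm_ball /ball_/= sub0r normrN.
Qed.

Lemma le_nrm_row v i : normc (v ord0 i) <= nrm v.
Proof.
apply/ler_addgt0Pr => e e0; apply: ltW.
have : ball (0 : 'rV[R[i]]_n) (nrm v + e)%:C v.
  by rewrite mx_norm_ball /ball_/= sub0r normrN nrmE ltcR ltrDl.
by move=> [_ /(_ ord0 i)]; rewrite mxE /ball/= sub0r normrN normr_normc ltcR.
Qed.

(** The constant depends on [z] only through [r], so the bound is uniform over points that keep a
    fixed distance from the complement of [Omega]. *)
Lemma bergman_pointwise Omega f z (r : R) : open Omega -> 0 < r ->
  holomorphic_on Omega f -> (forall w, nrm (w - z) < r -> Omega w) ->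
  ((normc (f z) ^+ 2)%:E <= ((36 / r ^+ 2) ^+ n)%:E * sq_int Omega f)%E.
Proof.
(* Points whose real coordinates are within s of those of z have distance at most 2 s < r from z, so
   this closed polysquare lies in Omega. Each coordinate costs the factor 4 / s ^ 2 = 36 / r ^ 2
   from [plane_mean]. *)
move=> oO r0 hf zO; set s := r / 3.
have s0 : 0 < s by rewrite divr_gt0.
pose D := @cvec R n @^-1` Omega.
pose P := ((fun t => ((normc (f (cvec t))) ^+ 2)%:E) \_ D)%E.
have mD : measurable D by exact: open_cvec_measurable.
have mP : measurable_fun setT P.
  apply/(measurable_restrictT _ _).1 => //.
  by apply/measurable_EFinP; apply: measurable_funX; exact: measurable_modulusD.
have P0 t : (0 <= P t)%E.
  by rewrite /P patchE; case: ifP => // _; rewrite lee_fin sqr_ge0.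
have PE t : D t -> P t = ((normc (f (cvec t))) ^+ 2)%:E.
  by move=> Dt; rewrite /P patchE mem_set.
pose a : n.-tuple T := [tuple (complex.Re (z ord0 i), complex.Im (z ord0 i)) | i < n].
have az : cvec a = z.
  by apply/rowP => i; rewrite mxE tnth_mktuple/=; case: (z ord0 i).
pose Q i : set T := [set w | `|w.1 - (tnth a i).1| <= s /\ `|w.2 - (tnth a i).2| <= s].
have Qa i : Q i (tnth a i) by rewrite /Q/= !subrr normr0; split; exact: ltW.
have mQ i : measurable (Q i).
  rewrite (_ : Q i = `[(tnth a i).1 - s, (tnth a i).1 + s]%classic `*`
                     `[(tnth a i).2 - s, (tnth a i).2 + s]%classic).
    by apply: measurableX; exact: measurable_itv.
  by apply/seteqP; split=> w /=; rewrite /Q/= !in_itv/= !ler_distl.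
have Qt t : (forall j, Q j (tnth t j)) -> D t.
  move=> tQ; apply: zO; apply: nrm_row_lt => // i; rewrite -az !mxE.
  have [h1 h2] := tQ i; apply: le_lt_trans (normc_le_ReIm _ _) _.
  by rewrite /s in h1 h2; lra.
have -> : sq_int Omega f = (\int[volume R n]_t P t)%E by rewrite /sq_int integral_mkcond.
rewrite -{1}az -PE; last exact: Qt.
apply: (@tuple_mean _ _ _ _ _ _ _ _ Q) => //; first by rewrite divr_ge0// sqr_ge0.
move=> i t tQ; set c := tnth a i.
have upQ (w : T) : Q i w -> D (upd_tuple t i w).
  move=> Qw; apply: Qt => j; rewrite tnth_mktuple.
  by case: eqP => [->//|_]; exact: tQ.
pose z' := cvec (upd_tuple t i c).
pose F (x : R[i]) := f (z' + x *: delta_mx ord0 i).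
have cvecE (x y : R) : cvec (upd_tuple t i (c.1 + x, c.2 + y)) = z' + (x +i* y) *: delta_mx ord0 i.
  apply/rowP => j; rewrite !mxE !tnth_mktuple eqxx/=.
  by case: eqP => _ /=; rewrite ?mulr1 ?mulr0 ?addr0.
have inQ (x y : R) : `|x| <= s -> `|y| <= s -> Q i (c.1 + x, c.2 + y).
  by move=> xs ys; rewrite /Q/= !(addrC c.1) !(addrC c.2) !addrK.
have DF (x y : R) : `|x| <= s -> `|y| <= s -> Omega (z' + (x +i* y) *: delta_mx ord0 i).
  by move=> xs ys; rewrite -cvecE; apply: upQ; exact: inQ.
have mup : measurable_fun setT (fun w : T => P (upd_tuple t i w)).
  by apply: measurableT_comp => //; exact: measurable_upd_tuple.
(* Cutting the integrand to [Q i] turns the integral over the plane in [plane_mean] into the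
   integral over [Q i] that [tuple_mean] requires. *)
have := @plane_mean R ((fun w : T => P (upd_tuple t i w)) \_ (Q i))%E F c s s0.
rewrite -integral_mkcond => /(_ _ _ _ _)/wrap[].
- apply/(measurable_restrictT _ _).1 => //; exact: measurable_funTS.
- by move=> w; rewrite patchE; case: ifP.
- move=> [x y] [/= xs ys]; have := @diff_line R _ _ f z' (delta_mx ord0 i) (x +i* y).
  by case => //; apply: hf; exact: DF.
- move=> x y xs ys; rewrite patchE mem_set; last exact: inQ.
  by rewrite PE ?cvecE//; apply: upQ; exact: inQ.
rewrite {1}/F scale0r addr0 => h.
rewrite PE; last by apply: upQ; exact: Qa.
rewrite -/z' (_ : 36 / r ^+ 2 = s ^- 2 * 4); last first.
  by rewrite /s; field; rewrite gt_eqF.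
rewrite (EFinM (s ^- 2) 4) -muleA.
rewrite -[X in (X%:E <= _)%E](mulKf (_ : s ^+ 2 != 0)); last by rewrite expf_neq0// gt_eqF.
by rewrite (EFinM (s ^- 2)) lee_wpmul2l// lee_fin invr_ge0 exprn_ge0// ltW.
Qed.

End bergman_sup.

(** * Limits of holomorphic functions along ultrafilters *)

Section ultrafilter_limits.
Context (R : realType).
Local Notation normc := (@Normc.normc R).

Lemma compact_in_square (M : R) : compact (in_square M).
Proof.
have -> : in_square M = (fun p : R * R => p.1 +i* p.2) @` (`[- M, M] `*` `[- M, M]).
  apply/seteqP; split=> [z [aM bM]|_ [[a b] [/= + +] <-]].
    by exists (complex.Re z, complex.Im z); [split; rewrite /= in_itv/= -ler_norml|case: z {aM bM}].
  by rewrite !in_itv/= -!ler_norml.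
apply: continuous_compact; last by apply: compact_setX; exact: segment_compact.
apply: continuous_subspaceT => p.
by apply: continuous_complex; [exact: cvg_fst|exact: cvg_snd].
Qed.

Lemma fmap_ultra (X Y : Type) (v : X -> Y) (F : set_system X) :
  UltraFilter F -> UltraFilter (v @ F).
Proof.
move=> UF; have PF : ProperFilter F by exact: ultra_proper.
split=> [|G PG FG]; first exact: fmap_proper_filter.
apply/seteqP; split=> // A GA.
have [//|nA] := in_ultra_setVsetC (v @^-1` A) UF.
have : G (~` A) by exact: FG.
by move=> /(filterI GA); rewrite setICr => /filter_not_empty.
Qed.

(** An ultrafilter containing a compact set converges in it; no subsequence has to be extracted, and
    all points can be treated at once. *)
Lemma ultra_bounded_cvg (X : Type) (F : set_system X) (v : X -> R[i]) (M : R) :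
  UltraFilter F -> (\forall x \near F, normc (v x) <= M) ->
  exists l, forall e : R, 0 < e -> \forall x \near F, normc (v x - l) < e.
Proof.
move=> UF vM.
have : (v @ F) (in_square M).
  apply: filterS vM => x xM; split; apply: le_trans xM.
    exact: abs_Re_normc.
  exact: abs_Im_normc.
have := @compact_in_square M; rewrite compact_ultra => /(_ (v @ F) (fmap_ultra v UF))/[apply].
move=> [l [_ /= vl]]; exists l => e e0.
have : nbhs l [set y | normc (y - l) < e].
  by apply/near_normP; exists e => // y; rewrite normr_normc ltcR.
by move/vl.
Qed.

(** The candidate derivative is S h, the sum of the h_j L_j, where L_j is the limit of the j-th
    partial derivatives, which the Cauchy estimate keeps bounded. One good member [u x] is fixed
    before the increment h; then l (z + h) - l z - S h splits into the increment of l - u x, the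
    differentiability error of [u x], and the distance between the differentials. *)
Lemma ultra_limit_differentiable n (X : Type) (F : set_system X)
    (u : X -> 'rV[R[i]]_n -> R[i]) (l : 'rV[R[i]]_n -> R[i]) (z : 'rV[R[i]]_n) (r M : R) :
  UltraFilter F -> 0 < r ->
  (\forall x \near F, forall w, nrm (w - z) < 2 * r -> differentiable (u x) w) ->
  (\forall x \near F, forall w, nrm (w - z) < 2 * r -> normc (u x w) <= M) ->
  (forall e, 0 < e ->
     \forall x \near F, forall w, nrm (w - z) < 2 * r -> normc (u x w - l w) <= e) ->
  differentiable l z.
Proof.
move=> UF r0 du uM ul.
have r20 : 0 < 2 * r by rewrite mulr_gt0.
pose b j : 'rV[R[i]]_n := delta_mx ord0 j.
have cvg_partial (j : 'I_n) : exists k : R[i], forall e : R, 0 < e ->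
    \forall x \near F, normc ('d (u x) z (b j) - k) < e.
  apply: (@ultra_bounded_cvg _ _ _ (12 * M / (2 * r) * nrm (b j))).
  apply: filterS2 du uM => x dx xM.
  exact: holomorphic_derivative_le.
have [L LP] := choice cvg_partial.
pose S (h : 'rV[R[i]]_n) : R[i] := \sum_j h ord0 j * L j.
have Slin : linear S.
  move=> a h k; rewrite /S scaler_sumr -big_split/=; apply: eq_bigr => j _.
  by rewrite !mxE mulrDl -mulrA.
pose Slm := GRing.isLinear.Build _ _ _ _ S Slin.
pose SL : {linear 'rV[R[i]]_n -> R[i]} := HB.pack S Slm.
have sum_le (c : 'I_n -> R[i]) (k : R) (h : 'rV[R[i]]_n) : (forall j, normc (c j) <= k) ->
    normc (\sum_j h ord0 j * c j) <= n%:R * k * nrm h.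
  move=> ck; apply: (@le_trans _ _ (\sum_(j < n) normc (h ord0 j * c j))).
    rewrite -lecR -normr_normc rmorph_sum/=; apply: le_trans (ler_norm_sum _ _ _) _.
    by apply: ler_sum => j _; rewrite normr_normc.
  apply: (@le_trans _ _ (\sum_(j < n) (nrm h * k))).
    apply: ler_sum => j _; rewrite Normc.normcM ler_pM ?normc_ge0//.
    exact: le_nrm_row.
  by rewrite sumr_const card_ord -[leLHS]mulr_natl (mulrC (nrm h)) mulrA.
have Scont : continuous SL.
  apply: bounded_linear_continuous; apply/linear_boundedP.
  pose k := \sum_j normc (L j).
  have Lk j : normc (L j) <= k.
    by rewrite /k (bigD1 j)//= lerDl sumr_ge0// => i _; exact: normc_ge0.
  have kR : (n%:R * k)%:C \is @Num.real R[i].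
    by rewrite ger0_real// ler0c mulr_ge0// sumr_ge0// => j _; exact: normc_ge0.
  near=> y => x; apply: (@le_trans _ _ ((n%:R * k)%:C * `|x|)).
    rewrite normr_normc nrmE -rmorphM lecR; exact: sum_le.
  by rewrite ler_wpM2r//; near: y; exact: nbhs_pinfty_ge.
apply: (eps_differentiable Scont) => e e0.
(* The three parts of the error are at most 24 / r, 1 and n times t |h|, so t = e / K makes their
   sum e |h|. *)
pose K : R := 24 / r + 1 + n%:R.
have K0 : 0 < K by rewrite /K -addrA ltr_wpDr ?addr_ge0// divr_gt0.
pose t := e / K.
have t0 : 0 < t by rewrite divr_gt0.
have [x [dx ux xL]] : exists x, [/\ forall w, nrm (w - z) < 2 * r -> differentiable (u x) w,
    forall w, nrm (w - z) < 2 * r -> normc (u x w - l w) <= t &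
    forall j, normc ('d (u x) z (b j) - L j) < t].
  near F => x; exists x; split; [by near: x|by near: x; exact: ul|].
  by move=> j; move: j; near: x; apply: filter_forall => j; exact: LP.
have dz : differentiable (u x) z by apply: dx; rewrite /nrm subrr normr0.
have [d d0 dP] := differentiable_eps dz t0.
exists (Num.min d r); first by rewrite lt_min d0.
move=> h; rewrite (nrmE h) ltcR lt_min => /andP[hd hr].
have hz : nrm (z - z) < 2 * r by rewrite /nrm subrr normr0.
have zh : nrm (z + h - z) < 2 * r.
  by rewrite addrAC subrr add0r; apply: lt_trans hr _; rewrite ltr_pMl// ltr1n.
(* As l is not yet known to be differentiable, a member [u y] close to it replaces it, at a cost e'
   that is arbitrarily small. Both members are within t of l on the ball, so u y - u x is bounded by
   2 t there, and 24 = 12 * 2. *)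
have h1 : normc (l (z + h) - u x (z + h) - (l z - u x z)) <= 24 / r * t * nrm h.
  apply/ler_addgt0Pr => e' e'0.
  have m0 : 0 < Num.min t (e' / 2) by rewrite lt_min t0 divr_gt0.
  have [y [dy uy]] : exists y, (forall w, nrm (w - z) < 2 * r -> differentiable (u y) w) /\
      forall w, nrm (w - z) < 2 * r -> normc (u y w - l w) <= Num.min t (e' / 2).
    near F => y; exists y; split; first by near: y.
    by near: y; exact: ul.
  have := @holomorphic_lipschitz R _ (fun w => u y w - u x w) z h r (2 * t).
  move=> /(_ _ _ hr)/wrap[].
  - by move=> w wz; apply: (@differentiableB _ _ _ (u y) (u x)); [exact: dy|exact: dx].
  - move=> w wz; rewrite (_ : u y w - u x w = (u y w - l w) - (u x w - l w)); last by ring.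
    apply: le_trans (le_normcD _ _) _; rewrite normcN mulr_natl mulr2n lerD ?ux//.
    by apply: le_trans (uy _ wz) _; rewrite ge_min lexx.
  move=> H.
  have -> : l (z + h) - u x (z + h) - (l z - u x z) =
    (u y (z + h) - u x (z + h) - (u y z - u x z)) + ((u y z - l z) - (u y (z + h) - l (z + h))).
    by ring.
  apply: le_trans (le_normcD _ _) _; apply: lerD.
    by rewrite (_ : 24 / r * t = 12 * (2 * t) / r)//; ring.
  apply: le_trans (le_normcD _ _) _; rewrite normcN (splitr e') lerD//.
    by apply: le_trans (uy _ hz) _; rewrite ge_min lexx orbT.
  by apply: le_trans (uy _ zh) _; rewrite ge_min lexx orbT.
have h2 : normc (u x (z + h) - u x z - 'd (u x) z h) <= t * nrm h.
  by have := dP h; rewrite (nrmE h) ltcR normr_normc -rmorphM lecR; apply.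
have h3 : normc ('d (u x) z h - S h) <= n%:R * t * nrm h.
  have hE : h = \sum_j h ord0 j *: b j by rewrite {1}(matrix_sum_delta h) big_ord1.
  rewrite [X in 'd (u x) z X]hE linear_sum/= /S -sumrB.
  under eq_bigr do rewrite linearZ/= -[_ *: 'd _ _ _]/(_ * 'd (u x) z _) -mulrBr.
  by apply: sum_le => j; exact: ltW.
rewrite normr_normc -rmorphM lecR -[SL h]/(S h).
have -> : l (z + h) - l z - S h = (l (z + h) - u x (z + h) - (l z - u x z)) +
    (u x (z + h) - u x z - 'd (u x) z h) + ('d (u x) z h - S h) by ring.
apply: le_trans (le_normcD _ _) _.
apply: le_trans (lerD (le_trans (le_normcD _ _) (lerD h1 h2)) h3) _.
rewrite -!mulrDl (_ : 24 / r * t + t + n%:R * t = e)//.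
rewrite -[X in _ + X + _]mul1r -!mulrDl -/K /t.
by rewrite mulrC divfK// gt_eqF.
Unshelve. all: by end_near. Qed.

End ultrafilter_limits.

(** * Compactness, margins and finite volume for bounded sets *)

Lemma nbhs_nrm (R : realType) (V : normedModType R[i]) (x : V) (d : R) : 0 < d ->
  nbhs x [set y | nrm (y - x) < d].
Proof. by move=> d0; apply/near_normP; exists d => // y; rewrite nrmE ltcR. Qed.

Section bounded_domains.
Context (R : realType) (n : nat).
Local Notation T := (measurableTypeR R * measurableTypeR R)%type.
Local Notation normc := (@Normc.normc R).
Implicit Types (A K Omega : set 'rV[R[i]]_n) (z w : 'rV[R[i]]_n).

Lemma bounded_nrm A : bounded_set A -> exists2 M : R, 0 < M & forall z, A z -> nrm z <= M.
Proof.
move=> /pinfty_ex_gt0[M M0 AM].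
have ME : (complex.Re M)%:C = M by rewrite RRe_real// gtr0_real.
exists (complex.Re M); first by rewrite -ltcR ME.
by move=> z /AM /=; rewrite nrmE -{1}ME lecR.
Qed.

Lemma bounded_closed_compact_complex A : bounded_set A -> closed A -> compact A.
Proof.
move=> /bounded_nrm[M M0 AM] cA.
apply: (subclosed_compact cA (rV_compact (fun=> @compact_in_square R M))).
move=> z /AM zM i; split; apply: le_trans zM; apply: le_trans (le_nrm_row z i).
  exact: abs_Re_normc.
exact: abs_Im_normc.
Qed.

(** If the ball of radius d about x lies in [Omega], then radius d / 2 serves all centres within d /
    2 of x; compactness turns these local radii into a common one. *)
Lemma compact_margin K Omega : compact K -> open Omega -> K `<=` Omega ->
  exists2 r : R, 0 < r & forall z w, K z -> nrm (w - z) < r -> Omega w.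
Proof.
move=> /compact_near_coveringP cK oO KO.
have := cK R (0^'+) (fun r z => forall w, nrm (w - z) < r -> Omega w) _.
move=> /(_ _ _)/wrap[].
  move=> x Kx; have /near_normP[d d0 dP] : nbhs x Omega.
    by apply: open_nbhs_nbhs; split=> //; exact: KO.
  exists ([set z | nrm (z - x) < d / 2], [set r | r < d / 2]).
    split; first by apply: nbhs_nrm; rewrite divr_gt0.
    by apply: nbhs_right_lt; rewrite divr_gt0.
  move=> [z r] [/= zx rd] w wz; apply: dP; rewrite nrmE ltcR.
  rewrite (_ : w - x = (w - z) + (z - x)); last by rewrite addrA subrK.
  apply: le_lt_trans (nrmD _ _) _; rewrite (splitr d) ltrD//.
  exact: lt_trans rd.
move=> H; near (0 : R)^'+ => r; exists r => // z w Kz.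
by move: (z) Kz (w); near: r.
Unshelve. all: by end_near. Qed.

Lemma bounded_volume_lty Omega : open Omega -> bounded_set Omega ->
  (volume R n (@cvec R n @^-1` Omega) < +oo)%E.
Proof.
move=> oO /bounded_nrm[M M0 OM].
pose A (i : 'I_n) : set T := `[- M, M]%classic `*` `[- M, M]%classic.
have mA i : measurable (A i) by apply: measurableX; exact: measurable_itv.
have [mS SE] := tuple_measureX (lebesgue2 R) mA.
apply: (@le_lt_trans _ _ (volume R n [set t : n.-tuple T | forall i, A i (tnth t i)])).
  apply: le_measure; rewrite ?inE//; first exact: open_cvec_measurable.
  move=> t /= /OM tM i.
  have tiM : normc ((tnth t i).1 +i* (tnth t i).2) <= M.
    by apply: le_trans tM; have := le_nrm_row (cvec t) i; rewrite mxE.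
  split; rewrite /= in_itv/= -ler_norml; apply: le_trans tiM.
    exact: (abs_Re_normc ((tnth t i).1 +i* (tnth t i).2)).
  exact: (abs_Im_normc ((tnth t i).1 +i* (tnth t i).2)).
rewrite [X in (X < _)%E]SE.
have fA i : (lebesgue2 R) (A i) \is a fin_num.
  rewrite [X in X \is a _]product_measure1E//; try exact: measurable_itv.
  by rewrite fin_numM// [X in X \is a _]lebesgue_measure_itv/=; case: ifP.
by rewrite ltey_eq; apply/orP; left; apply: prode_fin_num => i _; exact: fA.
Qed.

Lemma sq_int_le Omega f (e : R) : open Omega -> 0 <= e -> holomorphic_on Omega f ->
  (forall z, Omega z -> normc (f z) <= e) ->
  (sq_int Omega f <= (e ^+ 2)%:E * volume R n (@cvec R n @^-1` Omega))%E.
Proof.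
move=> oO e0 hf fe; have mD := open_cvec_measurable oO.
rewrite -integral_cst//; apply: ge0_le_integral => //.
- by move=> t _; rewrite lee_fin sqr_ge0.
- by apply/measurable_EFinP; apply: measurable_funX; exact: measurable_modulusD.
- by move=> t /fe te; rewrite lee_fin lerXn2r ?nnegrE// normc_ge0.
Qed.

End bounded_domains.

(** * The composition operator and its compactness *)

Section composition.
Context (R : realType) (n : nat) (Omega : set 'rV[R[i]]_n) (oOmega : open Omega).
Context (phi : 'rV[R[i]]_n -> 'rV[R[i]]_n).
Hypothesis bOmega : bounded_set Omega.
Hypothesis hphi : holomorphic_on Omega phi.
Hypothesis phiOmega : closure (phi @` Omega) `<=` Omega.
Local Notation normc := (@Normc.normc R).
Local Notation B := (bergman oOmega).
Local Notation vol := (fine (volume R n (@cvec R n @^-1` Omega))).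
Implicit Types (f g : B) (z w : 'rV[R[i]]_n).

Let volE : volume R n (@cvec R n @^-1` Omega) = vol%:E.
Proof. by rewrite fineK// ge0_fin_numE// bounded_volume_lty. Qed.

Let K := closure (phi @` Omega).

Let compact_K : compact K.
Proof.
apply: bounded_closed_compact_complex; last exact: closed_closure.
have /bounded_nrm[M M0 OM] := bOmega.
exists M%:C; split; first by rewrite ger0_real// ler0c ltW.
move=> x Mx z /= /phiOmega/OM zM; apply: ltW; apply: le_lt_trans Mx.
by rewrite nrmE lecR.
Qed.

Let K_phi z : Omega z -> K (phi z).
Proof. by move=> Oz; apply: subset_closure; exists z. Qed.

Lemma bergman_set_bounded (h : 'rV[R[i]]_n -> R[i]) (M : R) : 0 <= M ->
  holomorphic_on Omega h -> (forall z, Omega z -> normc (h z) <= M) ->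
  (forall z, ~ Omega z -> h z = 0) -> bergman_set Omega h.
Proof.
move=> M0 hh hM h0; split=> //.
by apply: le_lt_trans (sq_int_le oOmega M0 hh hM) _; rewrite volE -EFinM ltry.
Qed.

Lemma L2norm_le (h : 'rV[R[i]]_n -> R[i]) (e : R) : 0 <= e ->
  holomorphic_on Omega h -> (forall z, Omega z -> normc (h z) <= e) ->
  L2norm Omega h <= e * Num.sqrt vol.
Proof.
move=> e0 hh he; have h1 := sq_int_le oOmega e0 hh he; rewrite volE -EFinM in h1.
rewrite /L2norm; apply: (@le_trans _ _ (Num.sqrt (e ^+ 2 * vol))).
  rewrite ler_wsqrtr// -lee_fin fineK// ge0_fin_numE ?sq_int_ge0//.
  exact: le_lt_trans h1 (ltry _).
by rewrite sqrtrM ?sqr_ge0// sqrtr_sqr ger0_norm.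
Qed.

Let ball_bound : exists r M : R, [/\ 0 < r, 0 <= M &
  forall f, (forall z w, K z -> nrm (w - z) < 2 * r -> Omega w) /\
   (nrm f <= 1 -> forall z w, K z -> nrm (w - z) < 2 * r -> normc (f w) <= M)].
Proof.
have [r r0 rO] := compact_margin compact_K oOmega phiOmega.
have r40 : 0 < r / 4 by rewrite divr_gt0.
have r20 : 0 < r / 2 by rewrite divr_gt0.
(* Half of the margin r, namely 2 (r / 4), is the width of the neighbourhood of K; the other half is
   the radius left for [bergman_pointwise] about each point of that neighbourhood. *)
exists (r / 4), (Num.sqrt ((36 / (r / 2) ^+ 2) ^+ n)).
split; [exact: r40|exact: sqrtr_ge0|move=> f].
have rE : 2 * (r / 4) = r / 2 by field.
rewrite rE; split=> [z w Kz wz|f1 z w Kz wz].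
  by apply: rO Kz _; apply: lt_le_trans wz _; lra.
have [hf foo _] := bergmanP f.
have := @bergman_pointwise R n Omega f w (r / 2) oOmega r20 hf.
move=> /(_ _)/wrap[].
  move=> y yw; apply: rO Kz _; rewrite (_ : y - z = (y - w) + (w - z)); last by rewrite addrA subrK.
  by apply: le_lt_trans (nrmD _ _) _; rewrite (splitr r) ltrD.
have f0 := sq_int_ge0 Omega f.
rewrite -(@fineK _ (sq_int Omega f)) ?ge0_fin_numE// -EFinM lee_fin => h.
rewrite -[leLHS]ger0_norm ?normc_ge0// -sqrtr_sqr ler_wsqrtr//.
apply: le_trans h _; rewrite ler_piMr ?exprn_ge0// ?divr_ge0 ?sqr_ge0//.
have : L2norm Omega f <= 1 by move: f1; rewrite -lecR -nrmE bergman_normE lecR.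
by rewrite /L2norm -{1}sqrtr1 ler_sqrt.
Qed.

(** Bergman functions are represented by functions vanishing outside [Omega], while [f \o phi] is
    arbitrary there. *)
Definition restrict0 (h : 'rV[R[i]]_n -> R[i]) z := if `[< Omega z >] then h z else 0.

Lemma restrict0_in h z : Omega z -> restrict0 h z = h z.
Proof. by move=> Oz; rewrite /restrict0 asboolT. Qed.

Lemma restrict0_out h z : ~ Omega z -> restrict0 h z = 0.
Proof. by move=> Oz; rewrite /restrict0 asboolF. Qed.

Lemma holomorphic_restrict0 h : holomorphic_on Omega h -> holomorphic_on Omega (restrict0 h).
Proof.
move=> hh z Oz; apply: near_eq_differentiable (hh z Oz).
have : nbhs z Omega by exact: open_nbhs_nbhs.
by apply: filterS => w Ow; rewrite restrict0_in.
Qed.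

Let phi_in z : Omega z -> Omega (phi z).
Proof. by move=> Oz; apply: phiOmega; exact: K_phi. Qed.

(** Square integrability comes from boundedness of [f] on [K] and finite volume, not from a change
    of variables, so the Jacobian of [phi] does not enter. *)
Let comp_set f : bergman_set Omega (restrict0 (f \o phi)).
Proof.
have [r [M [r0 M0 bd]]] := ball_bound.
have hc : holomorphic_on Omega (f \o phi).
  move=> z Oz; apply: differentiable_comp; first exact: hphi.
  by have [hf _ _] := bergmanP f; apply: hf; exact: phi_in.
have N0 : 0 <= nrm f + 1 by rewrite addr_ge0// nrm_ge0.
have N1 : 0 < nrm f + 1 by rewrite ltr_wpDl// nrm_ge0.
apply: (@bergman_set_bounded _ ((nrm f + 1) * M)).
- by rewrite mulr_ge0.
- exact: holomorphic_restrict0.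
- move=> z Oz; rewrite restrict0_in//=.
  (* Dividing by nrm f + 1 puts g in the unit ball without excluding f = 0. *)
  pose g : B := (nrm f + 1)^-1%:C *: f.
  have g1 : nrm g <= 1.
    rewrite nrmZ normc_real ger0_norm ?invr_ge0// mulrC ler_pdivrMr// mul1r.
    by rewrite lerDl.
  have := (bd g).2 g1 (phi z) (phi z) (K_phi Oz).
  rewrite /nrm subrr normr0 -/(nrm f) => /(_ _)/wrap[]; first by rewrite mulr_gt0.
  rewrite -[g (phi z)]/((nrm f + 1)^-1%:C * f (phi z)) Normc.normcM normc_real.
  by rewrite ger0_norm ?invr_ge0// ler_pdivrMl.
- by move=> z; exact: restrict0_out.
Qed.

Definition comp_op f : B := Bergman (mem_set (comp_set f)).

Lemma comp_opE f z : Omega z -> comp_op f z = f (phi z).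
Proof. by move=> Oz; rewrite -[LHS]/(restrict0 (f \o phi) z) restrict0_in. Qed.

Lemma comp_op_linear : linear comp_op.
Proof.
move=> a f g; apply: val_inj; apply/funext => z.
rewrite -[RHS]/(a * restrict0 (f \o phi) z + restrict0 (g \o phi) z).
rewrite -[LHS]/(restrict0 ((a *: f + g) \o phi) z).
have [Oz|nOz] := pselect (Omega z); first by rewrite !restrict0_in.
by rewrite !restrict0_out// mulr0 addr0.
Qed.

HB.instance Definition _ := GRing.isLinear.Build _ _ _ _ comp_op comp_op_linear.

(* It contains the image of the unit ball, since the unit ball is bounded and uniformly
   Lipschitz near closure (phi @` Omega). *)
Definition phi_lipschitz (r C M : R) : set B :=
  [set g | forall z, Omega z -> normc (g z) <= M /\
    forall w, Omega w -> nrm (phi w - phi z) < r ->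
      normc (g w - g z) <= C * nrm (phi w - phi z)].

(** An Arzela-Ascoli argument with [K] as compact base, although the functions live on [Omega]:
    equicontinuity compares points only through their images under [phi]. *)
Lemma compact_phi_lipschitz (r C M : R) : 0 < r -> 0 <= C -> 0 <= M ->
  compact (phi_lipschitz r C M).
Proof.
move=> r0 C0 M0; rewrite compact_ultra => F UF FT.
have [l lP] : exists l : 'rV[R[i]]_n -> R[i], forall z (e : R), 0 < e ->
    Omega z -> \forall g \near F, normc ((g : B) z - l z) < e.
  have H z : exists k : R[i], forall e : R, 0 < e ->
      Omega z -> \forall g \near F, normc ((g : B) z - k) < e.
    have [Oz|nOz] := pselect (Omega z); last by exists 0.
    have [k kP] := @ultra_bounded_cvg R B F (fun g => g z) M UF
      (filterS (fun g (Tg : phi_lipschitz r C M g) => (Tg z Oz).1) FT).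
    by exists k => e e0 _; exact: kP.
  by have [l lP] := choice H; exists l.
have lM z : Omega z -> normc (l z) <= M.
  move=> Oz; apply/ler_addgt0Pr => e e0.
  have [g [Tg gl]] : exists g, phi_lipschitz r C M g /\ normc (g z - l z) < e.
    by near F => g; exists g; split; near: g; [exact: FT|exact: lP].
  rewrite -(subKr (g z) (l z)); apply: le_trans (le_normcD _ _) _.
  by rewrite normcN; apply: lerD; [exact: (Tg z Oz).1|exact: ltW].
have lC z w : Omega z -> Omega w -> nrm (phi w - phi z) < r ->
    normc (l w - l z) <= C * nrm (phi w - phi z).
  move=> Oz Ow wz; apply/ler_addgt0Pr => e e0.
  have e20 : 0 < e / 2 by rewrite divr_gt0.
  have [g [Tg gz gw]] : exists g, [/\ phi_lipschitz r C M g, normc (g z - l z) < e / 2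
      & normc (g w - l w) < e / 2].
    by near F => g; exists g; split; near: g; [exact: FT|exact: lP|exact: lP].
  rewrite (_ : l w - l z = (g w - g z) + ((g z - l z) - (g w - l w))); last by ring.
  apply: le_trans (le_normcD _ _) _; apply: lerD; first by apply: (Tg z Oz).2.
  apply: le_trans (le_normcD _ _) _; rewrite normcN (splitr e) lerD// ltW//.
have unif (e : R) : 0 < e -> \forall g \near F, forall z, Omega z -> normc ((g : B) z - l z) <= e.
  move=> e0; have /compact_near_coveringP cK := compact_K.
  have C1 : 0 < C + 1 by rewrite ltr_wpDl.
  (* Since d <= r, the Lipschitz condition applies to images closer than d, and there it costs at
     most C d <= e / 3. Taking C + 1 allows C = 0. *)
  pose d := Num.min r (e / (3 * (C + 1))).
  have d0 : 0 < d by rewrite lt_min r0 divr_gt0// mulr_gt0.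
  have Cd : C * d <= e / 3.
    apply: (@le_trans _ _ ((C + 1) * (e / (3 * (C + 1))))).
      by apply: ler_pM => //; [exact: ltW|rewrite lerDl|rewrite ge_min lexx orbT].
    by rewrite le_eqVlt; apply/orP; left; apply/eqP; field; rewrite gt_eqF.
  (* Indexed by the image point, so that the covering runs over K; the condition is vacuous at
     points of K that are not values of phi. *)
  pose P g x := forall z, Omega z -> phi z = x -> normc (g z - l z) <= e.
  have H x : K x -> \forall x' \near x & g \near F, P g x'.
    move=> Kx.
    (* x lies only in the closure of the image, so a nearby value phi z0 stands in for it, and
       pointwise convergence is used at z0. *)
    have [_ [[z0 Oz0 <-]] zx] : phi @` Omega `&` [set y | nrm (y - x) < d / 2] !=set0.
      by apply: Kx; apply: nbhs_nrm; rewrite divr_gt0.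
    exists ([set y | nrm (y - x) < d / 2],
            [set g | phi_lipschitz r C M g /\ normc (g z0 - l z0) < e / 3]).
      split; first by apply: nbhs_nrm; rewrite divr_gt0.
      by apply: filterI; [exact: FT|apply: lP => //; rewrite divr_gt0].
    move=> [y g] [/= yx [Tg gz0]] z Oz zE; rewrite -zE in yx.
    have zz0 : nrm (phi z - phi z0) < d.
      rewrite (_ : phi z - phi z0 = (phi z - x) + (x - phi z0)); last by rewrite addrA subrK.
      by apply: le_lt_trans (nrmD _ _) _; rewrite (nrmBC x) (splitr d) ltrD.
    have zr : nrm (phi z - phi z0) < r by apply: lt_le_trans zz0 _; rewrite ge_min lexx.
    have Ce : C * nrm (phi z - phi z0) <= e / 3.
      by apply: le_trans Cd; rewrite ler_wpM2l// ltW.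
    rewrite (_ : g z - l z = (g z - g z0) + (g z0 - l z0) - (l z - l z0)); last by ring.
    apply: le_trans (le_normcD _ _) _; rewrite normcN.
    rewrite (_ : e = e / 3 + e / 3 + e / 3); last by field.
    apply: lerD; last by apply: le_trans (lC z0 z Oz0 Oz zr) Ce.
    apply: le_trans (le_normcD _ _) _; apply: lerD; last exact: ltW.
    by apply: le_trans Ce; apply: (Tg z0 Oz0).2.
  apply: filterS (cK B F P _ H) => g gP z Oz.
  exact: (gP (phi z) (K_phi Oz) z Oz).
have hl : holomorphic_on Omega l.
  move=> z Oz; have /near_normP[d d0 dP] : nbhs z Omega by exact: open_nbhs_nbhs.
  have d20 : 0 < d / 2 by rewrite divr_gt0.
  have dO w : nrm (w - z) < 2 * (d / 2) -> Omega w.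
    by rewrite mulrC divfK// => wz; apply: dP; rewrite nrmE ltcR.
  apply: (@ultra_limit_differentiable R n B F (fun g => g) l z (d / 2) M UF d20).
  - by apply: nearW => g w /dO Ow; have [hg _ _] := bergmanP g; exact: hg.
  - by apply: filterS FT => g Tg w /dO Ow; have [] := Tg w Ow.
  - by move=> e /unif; apply: filterS => g gP w /dO; exact: gP.
have ls : bergman_set Omega (restrict0 l).
  apply: (@bergman_set_bounded _ M) => //.
  - exact: holomorphic_restrict0.
  - by move=> z Oz; rewrite restrict0_in//; exact: lM.
  - by move=> z; exact: restrict0_out.
pose L : B := Bergman (mem_set ls).
have LE z : Omega z -> L z = l z by move=> Oz; rewrite -[LHS]/(restrict0 l z) restrict0_in.
exists L; split.
  by move=> z Oz; rewrite LE//; split=> [|w Ow wz]; [exact: lM|rewrite LE//; exact: lC].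
move=> P /near_normP[d d0 dP].
(* A uniform error t costs at most t times the square root of the volume in norm. *)
have s0 : 0 < Num.sqrt vol + 1 by rewrite ltr_wpDl// sqrtr_ge0.
have t0 : 0 < d / (Num.sqrt vol + 1) by rewrite divr_gt0.
apply: filterS (unif _ t0) => g gP; apply: dP.
rewrite bergman_normE ltcR.
apply: (@le_lt_trans _ _ (d / (Num.sqrt vol + 1) * Num.sqrt vol)).
  apply: L2norm_le; first exact: ltW.
    by have [] := bergmanP (g - L).
  move=> z Oz; rewrite -[X in normc X]/(g z - L z) LE//; exact: gP.
by rewrite mulrAC ltr_pdivrMr// ltr_pM2l// ltrDl.
Unshelve. all: by end_near. Qed.

Lemma comp_op_compact : compact_operator comp_op.
Proof.
have [r [M [r0 M0 bd]]] := ball_bound.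
(* This is the Lipschitz constant that [holomorphic_lipschitz] gives on balls of radius 2 r about
   points of K, where the unit ball is bounded by M. *)
have C0 : 0 <= 12 * M / r by rewrite divr_ge0 ?mulr_ge0// ltW.
have cT := compact_phi_lipschitz r0 C0 M0.
have clT : closed (phi_lipschitz r (12 * M / r) M).
  by apply: compact_closed cT; exact: norm_hausdorff.
apply: subclosed_compact cT _; first exact: closed_closure.
rewrite ((closure_id _).1 clT).
apply: closureS => _ [f /= f1 <-] z Oz.
have {}f1 : nrm f <= 1 by apply: ltW; rewrite -ltcR -nrmE.
have [bO bM] := bd f.
have zz : nrm (phi z - phi z) < 2 * r by rewrite /nrm subrr normr0 mulr_gt0.
split; first by rewrite comp_opE//; exact: (bM f1 _ _ (K_phi Oz)).
move=> w Ow wz; rewrite !comp_opE//.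
have := @holomorphic_lipschitz R _ f (phi z) (phi w - phi z) r M _ _ wz.
rewrite (_ : phi z + (phi w - phi z) = phi w); last by rewrite addrC subrK.
apply.
  move=> y /(bO _ _ (K_phi Oz)) Oy; have [hf _ _] := bergmanP f; exact: hf.
by move=> y; exact: (bM f1 _ _ (K_phi Oz)).
Qed.

End composition.

Theorem proposition2 (R : realType) (n : nat) (Omega : set 'rV[R[i]]_n)
    (oOmega : open Omega) (phi : 'rV[R[i]]_n -> 'rV[R[i]]_n) :
  (0 < n)%N ->
  Omega !=set0 -> connected Omega ->
  bounded_set Omega ->
  pseudoconvex Omega ->
  holomorphic_on Omega phi ->
  phi @` Omega `<=` Omega ->
  closure (phi @` Omega) `<=` Omega ->
  exists C_phi : {linear bergman oOmega -> bergman oOmega},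
    (forall (f : bergman oOmega) z, Omega z -> C_phi f z = f (phi z)) /\
    compact_operator C_phi.
Proof.
move=> _ _ _ bO _ hphi _ phiO.
exists (comp_op bO hphi phiO); split; first exact: comp_opE.
exact: comp_op_compact.
Qed.
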